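(* Let $(X,d,\mu)$ be a doubling metric measure space and let $p\ge1$. Assume that the following $p$-Poincaré inequality holds: there are constants $C>0$ and $\lambda\ge1$ such that for every locally Lipschitz function $f$ on $X$, every $x\in X$ and every $r>0$, $$\int_{B(x,r)}|f(y)-f_{B(x,r)}|^p\,d\mu(y)\le C r^p\int_{B(x,\lambda r)}(\mathrm{Lip} f)(y)^p\,d\mu(y).$$ Then the property $\mathcal P(p,1)$ holds. Moreover, there exist constants $C_1,C_2>0$ such that for every $f\in KS^{1,p}(X)$, $$C_1\,\mathrm{Var}_p(f)^p\le\inf_{(f_n)}\liminf_{n\to+\infty}\int_X(\mathrm{Lip} f_n)(y)^p\,d\mu(y)\le C_2\,\mathrm{Var}_p(f)^p,$$ where the infimum is taken over the sequences of locally Lipschitz functions $f_n$ such that $f_n\to f$ in $L^p_{loc}(X,\mu)$.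
   Context: Setting: $(X,d)$ is a metric space with more than one point, $\mu$ is a Borel regular measure which is positive and doubling: there is $C>0$ with $0<\mu(B(x,2r))\le C\mu(B(x,r))<+\infty$ for all $x\in X$, $r>0$, where $B(x,r)=\{y:d(x,y)<r\}$. $(\mathrm{Lip} f)(y)=\limsup_{r\to0}\sup_{x\in X,\,d(x,y)\le r}\frac{|f(x)-f(y)|}{r}$ and $f_{B(x,r)}=\frac1{\mu(B(x,r))}\int_{B(x,r)}f\,d\mu$. $L^p_{loc}(X,\mu)$ is the space of locally $p$-integrable functions; $f_n\to f$ in $L^p_{loc}(X,\mu)$ means that $\int_B|f_n-f|^p\,d\mu\to0$ for every ball $B\subset X$. For $p\ge1$, $\alpha\ge0$, $r>0$, $f\in L^p(X,\mu)$ put $$E_{p,\alpha}(f,r)=\int_X\frac{1}{\mu(B(x,r))}\int_{B(x,r)}\frac{|f(y)-f(x)|^p}{r^{p\alpha}}\,d\mu(y)\,d\mu(x).$$ $\mathcal B^{\alpha,p}(X)=\{f\in L^p(X,\mu):\sup_{r>0}E_{p,\alpha}(f,r)<+\infty\}$ and $KS^{\alpha,p}(X)=\{f\in L^p(X,\mu):\limsup_{r\to0}E_{p,\alpha}(f,r)<+\infty\}$. ''Constant'' means constant $\mu$-a.e. The $L^p$ critical Besov exponent is $\alpha_p=\sup\{\alpha\ge0:\mathcal B^{\alpha,p}(X)\text{ contains non-constant functions}\}$. Property $\mathcal P(p,\alpha)$: $KS^{\alpha,p}(X)$ contains non-constant functions and there is a constant $C\ge1$ such that for every $f\in KS^{\alpha,p}(X)$,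 $\sup_{r>0}E_{p,\alpha}(f,r)\le C\liminf_{r\to0}E_{p,\alpha}(f,r)$. (If $\mathcal P(p,\alpha)$ holds, then $\alpha=\alpha_p$.) $\mathrm{Var}_p(f)=\liminf_{r\to0}E_{p,\alpha_p}(f,r)^{1/p}$. *)

(* Defs.v *)
From HB Require Import structures.
From mathcomp Require Import all_boot all_order all_algebra.
From mathcomp Require Import all_classical all_reals all_analysis.

Set Implicit Arguments.
Unset Strict Implicit.
Unset Printing Implicit Defensive.

Import Order.TTheory GRing.Theory Num.Theory.
Import numFieldNormedType.Exports.

Local Open Scope classical_set_scope.
Local Open Scope ring_scope.

(* A metric space together with a sigma-algebra; no compatibility is built in,
   it comes from [borel_regular] below. The open balls [ball x r] are
   [[set y | mdist x y < r]] (lemma [ballEmdist]). *)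
#[short(type="metricMeasurableType")]
HB.structure Definition MetricMeasurable (K : numDomainType)
    (d : measure_display) :=
  { M of Metric K M & Measurable d M }.

Section definitions.
Context (R : realType) (d : measure_display) (X : metricMeasurableType R d).
Implicit Types (mu : {measure set X -> \bar R}) (f : X -> R) (p alpha : R).

(* The sigma-algebra may be larger than the Borel one (e.g. the Caratheodory
   sigma-algebra of a Borel regular outer measure). *)
Definition borel_regular mu : Prop :=
  (forall U : set X, open U -> measurable U) /\
  (forall A : set X, measurable A ->
     exists B : set X, [/\ <<s open >> B, A `<=` B & mu B = mu A]).

Definition doubling mu : Prop :=
  exists2 C : R, 0 < C & forall (x : X) (r : R), 0 < r ->
    [/\ (0 < mu (ball x (2 * r)))%E,
        (mu (ball x (2 * r)) <= C%:E * mu (ball x r))%E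
      & (C%:E * mu (ball x r) < +oo)%E].

Definition locally_lipschitz f : Prop :=
  forall x : X, exists (r K : R), 0 < r /\
    (forall y z : X, ball x r y -> ball x r z ->
       `|f y - f z| <= K * mdist y z).

(* Not assumed finite, hence extended-real valued. *)
Definition Lip f (y : X) : \bar R :=
  limf_esup (fun r : R =>
    ereal_sup [set (`|f x - f y| / r)%:E | x in [set x | mdist x y <= r]])
  0^'+.

(* When f is not integrable on A this is a junk value; in [poincare] the left
   integral is then +oo, whichever real number is subtracted from f. *)
Definition mean mu f (A : set X) : R :=
  (fine (mu A))^-1 * \int[mu]_(y in A) f y.

Definition poincare mu p : Prop :=
  exists (C lambda : R), [/\ 0 < C, 1 <= lambda &
    forall f, locally_lipschitz f -> forall (x : X) (r : R), 0 < r ->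
      (\int[mu]_(y in ball x r) (`|f y - mean mu f (ball x r)| `^ p)%:E
       <= (C * r `^ p)%:E *
          \int[mu]_(y in ball x (lambda * r)) (Lip f y `^ p))%E].

(* Membership of the f_n in L^p_loc is not demanded: it is used for locally
   Lipschitz f_n, which are bounded near every point. *)
Definition cvg_Lploc mu p (f_ : nat -> X -> R) f : Prop :=
  forall (x : X) (r : R), 0 < r ->
    (\int[mu]_(y in ball x r) (`|f_ n y - f y| `^ p)%:E)%E
      @[n --> \oo] --> 0%E.

Definition E mu p alpha f (r : R) : \bar R :=
  (\int[mu]_x ((mu (ball x r))^-1 *
     \int[mu]_(y in ball x r) (`|f y - f x| `^ p / r `^ (p * alpha))%:E))%E.

Definition Besov mu p alpha : set (X -> R) :=
  [set f | f \in Lfun mu p%:E /\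
           (ereal_sup [set E mu p alpha f r | r in [set r : R | (0 < r)%R]] < +oo)%E].

Definition KS mu p alpha : set (X -> R) :=
  [set f | f \in Lfun mu p%:E /\
           (limf_esup (E mu p alpha f) 0^'+ < +oo)%E].

Definition ae_constant mu f : Prop :=
  exists c : R, {ae mu, forall x, f x = c}.

Definition critical_exponent mu p : \bar R :=
  ereal_sup [set alpha%:E | alpha in
    [set alpha | 0 <= alpha /\
                 exists2 f, Besov mu p alpha f & ~ ae_constant mu f]].

Definition propertyP mu p alpha : Prop :=
  (exists2 f, KS mu p alpha f & ~ ae_constant mu f) /\
  (exists2 C : R, 1 <= C & forall f, KS mu p alpha f ->
     (ereal_sup [set E mu p alpha f r | r in [set r : R | (0 < r)%R]]
      <= C%:E * limf_einf (E mu p alpha f) 0^'+)%E).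

(* Meaningful only when the critical exponent is finite. *)
Definition Var mu p f : \bar R :=
  limf_einf (fun r : R =>
    (E mu p (fine (critical_exponent mu p)) f r `^ p^-1)%E) 0^'+.

Definition relaxed_energy mu p f : \bar R :=
  ereal_inf [set limn_einf (fun n => \int[mu]_y (Lip (f_ n) y `^ p))%E
            | f_ in [set f_ : nat -> X -> R |
                (forall n, locally_lipschitz (f_ n)) /\
                cvg_Lploc mu p f_ f]].

End definitions.

(* Main.v *)
Require Import Defs.
From HB Require Import structures.
From mathcomp Require Import all_boot all_order all_algebra.
From mathcomp Require Import all_classical all_reals all_analysis.
From mathcomp Require Import measurable_realfun ring lra.
Set Implicit Arguments.
Unset Strict Implicit.
Unset Printing Implicit Defensive.
Import Order.TTheory GRing.Theory Num.Theory.
Import numFieldNormedType.Exports.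
Local Open Scope classical_set_scope.
Local Open Scope ring_scope.

(** Fix a radius [r] and compare [f] at two points at distance less than [r]:
up to the factor [r `^ p], the energy [E mu p 1 f r] is [`|f y - f x| `^ p]
averaged over [y] in [ball x r] and integrated over [x] ([near_avg],
[E_near_avg]). By the doubling condition and Tonelli's theorem it is comparable,
at radii differing by a factor 2, with the average over pairs of points of a
common ball ([ball_avg_le], [near_avg_le]), and that is the quantity on which the
Poincare inequality acts.

The theorem follows from two estimates with constants that do not depend on
[f]. For every radius, the energy of [f] is at most a multiple of the relaxed
energy ([E_le_relaxed_energy]); and the relaxed energy of [f] is at most a
multiple of the lower limit of the energies at small radii
([relaxed_energy_le_liminf]). Chained, they bound the energies at all radii by
their lower limit, which is property P; each of them separately is one of the
two inequalities between the relaxed energy and the variation.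

For the first estimate, integrate the Poincare inequality for a locally
Lipschitz [g] over all balls of radius [2 * r]: this bounds the energy of [g] at
radius [r] by the integral of the [p]-th power of [Lip g] ([near_avg_le_Lip]).
At a fixed radius the energy is stable under convergence in [L^p] on balls,
because it contains differences and no derivatives ([near_avg_ball_perturb]), so
the bound passes from a sequence of locally Lipschitz functions to its limit
([near_avg_le_liminf]).

For the second estimate, replace [f x] by its average against the tent
function [max 0 (r - mdist x z)] ([smooth]). As the tent is Lipschitz in [x], so
is the average, with a local constant bounded by the mean oscillation of [f] in
the ball of radius [2 * r]; integrating, the Lipschitz energy of [smooth r] is
at most a multiple of the energy of [f] at radius [4 * r]
([integral_Lip_smooth_le]), and the integral of [`|smooth r x - f x| `^ p] is at
most a multiple of [r `^ p] times that energy ([integral_smooth_dist_le],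
[near_avg_radius]). Apply this along radii at which the energy approaches its
lower limit.

The critical exponent is 1: a tent function has bounded energy at exponent 1
([KS_nonconstant]), and if [f] has bounded energies at an exponent larger than
1, its energies at exponent 1 tend to 0, hence vanish at all radii by property
P, which makes [f] constant ([critical_exponent_eq1]). *)

(** * Powers, lower limits and integrals *)

Section powers.
Context (R : realType).
Implicit Types (a b c p t : R).

Lemma powR_le_compat p a b : 0 <= p -> 0 <= a -> a <= b -> a `^ p <= b `^ p.
Proof.
by move=> p0 a0 ab; apply: ge0_ler_powR; rewrite ?nnegrE// (le_trans a0).
Qed.

Lemma poweR_le_compat p (x y : \bar R) : 0 <= p -> (0 <= x)%E -> (x <= y)%E ->
  (x `^ p <= y `^ p)%E.
Proof.
move=> p0 x0 xy; apply: gt0_ler_poweR => //.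
  by rewrite in_itv/= x0 leey.
by rewrite in_itv/= (le_trans x0 xy) leey.
Qed.

Lemma powRD3_le p a b c : 0 <= p -> 0 <= a -> 0 <= b -> 0 <= c ->
  (a + b + c) `^ p <= 3 `^ p * (a `^ p + b `^ p + c `^ p).
Proof.
move=> p0 a0 b0 c0.
have H t : 0 <= t -> a + b + c <= 3 * t -> (a + b + c) `^ p <= 3 `^ p * t `^ p.
  by move=> t0 h; rewrite -powRM//; apply: powR_le_compat => //; rewrite !addr_ge0.
have pa := powR_ge0 a p; have pb := powR_ge0 b p; have pc := powR_ge0 c p.
have [ab|ba] := leP a b; [have [bc|cb] := leP b c|have [ac|ca] := leP a c].
- apply: le_trans (H c c0 _) _; first by lra.
  by apply: ler_wpM2l; rewrite ?powR_ge0//; lra.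
- apply: le_trans (H b b0 _) _; first by lra.
  by apply: ler_wpM2l; rewrite ?powR_ge0//; lra.
- apply: le_trans (H c c0 _) _; first by lra.
  by apply: ler_wpM2l; rewrite ?powR_ge0//; lra.
- apply: le_trans (H a a0 _) _; first by lra.
  by apply: ler_wpM2l; rewrite ?powR_ge0//; lra.
Qed.

Lemma powRD_le p a b : 0 < p -> 0 <= a -> 0 <= b ->
  (a + b) `^ p <= 3 `^ p * (a `^ p + b `^ p).
Proof.
move=> p0 a0 b0; have := @powRD3_le p a b 0 (ltW p0) a0 b0 (lexx _).
by rewrite powR0 ?gt_eqF// !addr0.
Qed.

Lemma powR_dist_le p a b c : 0 < p ->
  `|a - b| `^ p <= 3 `^ p * (`|a - c| `^ p + `|b - c| `^ p).
Proof.
move=> p0; apply: le_trans (powRD_le p0 (normr_ge0 _) (normr_ge0 _)).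
apply: powR_le_compat => //; first exact: ltW.
by rewrite (distrC b c); exact: ler_distD.
Qed.

Lemma le_1D_powR p t : 1 <= p -> 0 <= t -> t <= 1 + t `^ p.
Proof.
move=> p1 t0; have [t1|/ltW t1] := leP t 1.
  by rewrite (le_trans t1)// lerDl powR_ge0.
by rewrite (le_trans (le1r_powR t1 p1))// lerDr.
Qed.

(** Above the level [a] the factor [(t / a) `^ (p - 1)] is at least 1. *)
Lemma le_truncation_powR p a t : 1 <= p -> 0 < a -> 0 <= t ->
  t <= a + a `^ (1 - p) * t `^ p.
Proof.
move=> p1 a0 t0; have [ta|at_] := leP t a.
  by rewrite (le_trans ta)// lerDl mulr_ge0// powR_ge0.
apply: ler_wpDl; first exact: ltW.
have t0' : 0 < t by exact: lt_trans at_.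
rewrite -[leLHS](powRr1 t0) -{1}(subrK p 1) powRD; last by rewrite (gt_eqF t0') implybT.
rewrite ler_wpM2r ?powR_ge0//.
have e : 1 - p = - (p - 1) by rewrite opprB.
rewrite e !powRN lef_pV2 ?posrE ?powR_gt0//.
by apply: powR_le_compat; [rewrite subr_ge0|exact: ltW|exact: ltW].
Qed.

End powers.

Section lower_limits.
Context (R : realType).

Lemma limf_einf_lt (U : choiceType) (T : filteredType U) (u : T -> \bar R)
    (F : set (set T)) M A :
  (limf_einf u F < M)%E -> F A -> exists2 x, A x & (u x < M)%E.
Proof.
rewrite limf_einfE => uM FA.
have /ereal_inf_lt[_ [x Ax <-] xM] : (ereal_inf (u @` A) < M)%E; last by exists x.
by apply: le_lt_trans uM; apply: ereal_sup_ubound; exists A.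
Qed.

Lemma limf_einf_ge0 (U : choiceType) (T : filteredType U) (u : T -> \bar R)
    (F : set (set T)) : F setT -> (forall v : T, 0 <= u v)%E -> (0 <= limf_einf u F)%E.
Proof.
move=> FT u0; rewrite limf_einfE; apply: le_ereal_sup_tmp.
exists (ereal_inf (u @` setT)); first by exists setT.
by apply: le_ereal_inf_tmp => _ [x _ <-].
Qed.

Lemma limf_einf_le_esup (U : choiceType) (T : filteredType U) (u : T -> \bar R)
    (F : set_system T) : ProperFilter F -> (limf_einf u F <= limf_esup u F)%E.
Proof.
move=> PF; rewrite limf_einfE limf_esupE.
apply: ge_ereal_sup => _ [A FA <-]; apply: le_ereal_inf_tmp => _ [B FB <-].
have [v [Av Bv]] := filter_ex (filterI FA FB).
apply: (@le_trans _ _ (u v)).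
  by apply: ereal_inf_lbound; exists v.
by apply: ereal_sup_ubound; exists v.
Qed.

Lemma limn_einf_le (u : nat -> \bar R) (M : \bar R) :
  (forall n, u n <= M)%E -> (limn_einf u <= M)%E.
Proof.
move=> uM; rewrite [limn_einf u](_ : _ = limf_einf u \oo)// limf_einfE.
apply: ge_ereal_sup => _ [A FA <-]; have [n An] := filter_ex FA.
by apply: ge_ereal_inf; exists (u n) => //; exists n.
Qed.

(** The power function and its inverse are monotone on the nonnegative extended
reals, so lower bounds can be carried across in both directions. *)
Lemma limf_einf_poweR (u : R -> \bar R) (F : set_system R) q :
  0 < q -> (forall r, 0 <= u r)%E -> F setT ->
  (limf_einf (fun r => u r `^ q^-1) F `^ q = limf_einf u F)%E.
Proof.
move=> q0 u0 FT; have qV0 : 0 < q^-1 by rewrite invr_gt0.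
have pow0 r : (0 <= u r `^ q^-1)%E by exact: poweR_ge0.
have lV0 := limf_einf_ge0 FT pow0; have l0 := limf_einf_ge0 FT u0.
have inf0 (v : R -> \bar R) (A : set R) :
    (forall r, 0 <= v r)%E -> (0 <= ereal_inf (v @` A))%E.
  by move=> v0; apply: le_ereal_inf_tmp => _ [r _ <-].
have VK (a : \bar R) : (0 <= a)%E -> ((a `^ q) `^ q^-1 = a)%E.
  by move=> a0; rewrite -poweRrM mulfV ?poweRe1// gt_eqF.
have KV (a : \bar R) : (0 <= a)%E -> ((a `^ q^-1) `^ q = a)%E.
  by move=> a0; rewrite -poweRrM mulVf ?poweRe1// gt_eqF.
apply/eqP; rewrite eq_le; apply/andP; split.
  rewrite -[leRHS](KV _ l0); apply: poweR_le_compat => //; first exact: ltW.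
  rewrite limf_einfE; apply: ge_ereal_sup => _ [A FA <-].
  rewrite -[leLHS]VK ?inf0//; apply: poweR_le_compat; [exact: ltW|exact: poweR_ge0|].
  rewrite limf_einfE; apply: le_ereal_sup_tmp.
  exists (ereal_inf (u @` A)); first by exists A.
  apply: le_ereal_inf_tmp => _ [r Ar <-]; rewrite -[leRHS](KV _ (u0 r)).
  apply: poweR_le_compat; [exact: ltW|exact: inf0|].
  by apply: ereal_inf_lbound; exists r.
rewrite [leLHS]limf_einfE; apply: ge_ereal_sup => _ [A FA <-].
rewrite -[leLHS]KV ?inf0//; apply: poweR_le_compat; [exact: ltW|exact: poweR_ge0|].
rewrite limf_einfE; apply: le_ereal_sup_tmp.
exists (ereal_inf ((fun r => u r `^ q^-1)%E @` A)); first by exists A.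
apply: le_ereal_inf_tmp => _ [r Ar <-].
apply: poweR_le_compat; [exact: ltW|exact: inf0|].
by apply: ereal_inf_lbound; exists r.
Qed.

End lower_limits.

Section power_mean.
Context (R : realType) (d : measure_display) (T : measurableType d).
Variable mu : {measure set T -> \bar R}.

(** The power mean inequality up to a constant. Only the part of [h] above half
of its average matters, and there [h] is at most a multiple of its power. *)
Lemma powR_average_le (p v a : R) (D : set T) (h : T -> R) :
  1 <= p -> measurable D -> 0 < v -> mu D = v%:E -> 0 <= a ->
  measurable_fun D h -> (forall y, 0 <= h y) ->
  ((a * v)%:E <= \int[mu]_(y in D) (h y)%:E)%E ->
  ((a `^ p)%:E <= (2 `^ p / v)%:E * \int[mu]_(y in D) (h y `^ p)%:E)%E.
Proof.
move=> p1 mD v0 muD a0 mh h0 hav.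
have p0 : 0 < p by exact: lt_le_trans p1.
have J0 : (0 <= \int[mu]_(y in D) (h y `^ p)%:E)%E.
  by apply: integral_ge0 => y _; rewrite lee_fin powR_ge0.
have K0 : 0 < 2 `^ p / v by rewrite divr_gt0// powR_gt0.
move: a0; rewrite le_eqVlt => /predU1P[<-|a0].
  by rewrite powR0 ?gt_eqF// mule_ge0// lee_fin ltW.
have b0 : 0 < a / 2 by rewrite divr_gt0.
have mhp : measurable_fun D (fun y => (h y `^ p)%:E).
  by apply/measurable_EFinP; exact: (measurableT_comp (measurable_powR p)).
have : ((a * v)%:E <= (a / 2 * v)%:E +
    ((a / 2) `^ (1 - p))%:E * \int[mu]_(y in D) (h y `^ p)%:E)%E.
  apply: (le_trans hav).
  apply: (@le_trans _ _ (\int[mu]_(y in D) ((a / 2)%:E +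
     ((a / 2) `^ (1 - p))%:E * (h y `^ p)%:E))%E).
    apply: ge0_le_integral => //.
    - by move=> y _; rewrite lee_fin.
    - exact/measurable_EFinP.
    - by apply: emeasurable_funD => //; exact: measurable_funeM.
    - by move=> y _; rewrite lee_fin; exact: le_truncation_powR.
  rewrite ge0_integralD//.
  - rewrite integral_cst// muD -EFinM ge0_integralZl//.
    + by move=> y _; rewrite lee_fin powR_ge0.
    + by rewrite lee_fin powR_ge0.
  - by move=> y _; rewrite lee_fin ltW.
  - by move=> y _; rewrite -EFinM lee_fin mulr_ge0// powR_ge0.
  - exact: measurable_funeM.
case: (\int[mu]_(y in D) (h y `^ p)%:E)%E J0 => [J J0|_ _|//]; last first.
  by rewrite gt0_muley ?lte_fin ?leey.
rewrite -EFinM -EFinD -EFinM !lee_fin => h1.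
have h2 : a / 2 * v <= (a / 2) `^ (1 - p) * J by lra.
have h3 : (a / 2) `^ p * v <= J.
  have e : (a / 2) `^ p = (a / 2) `^ (p - 1) * (a / 2).
    by rewrite [RHS]mulrC mulr_powRB1// ltW.
  rewrite e -mulrA (le_trans (ler_wpM2l (powR_ge0 _ _) h2))//.
  by rewrite mulrA -(opprB p 1) powRN mulfV ?mul1r// gt_eqF// powR_gt0.
have -> : a `^ p = 2 `^ p * (a / 2) `^ p.
  by rewrite -powRM ?ltW// mulrC divfK.
by rewrite -mulrA ler_wpM2l ?powR_ge0// [leRHS]mulrC ler_pdivlMr//.
Qed.

Lemma ge0_integral_eq0_ae (D : set T) (h : T -> \bar R) :
  measurable D -> measurable_fun D h -> (forall x, 0 <= h x)%E ->
  (\int[mu]_(x in D) h x = 0)%E -> {ae mu, forall x, D x -> h x = 0%E}.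
Proof.
move=> mD mh h0 ih; have [+ _] := ae_eq_integral_abs mu mD mh; apply.
by rewrite -[RHS]ih; apply: eq_integral => x _; rewrite gee0_abs.
Qed.

End power_mean.

(** * Balls and their measures in a doubling space *)

Section balls.
Context (R : realType) (d : measure_display) (X : metricMeasurableType R d).
Implicit Types (x y z : X) (r s : R).

Lemma ballP x r y : ball x r y <-> mdist x y < r.
Proof. by rewrite ballEmdist. Qed.

Lemma subset_ball x y r s : mdist x y + r <= s -> ball y r `<=` ball x s.
Proof.
move=> xys z /ballP yz; apply/ballP; apply: lt_le_trans xys.
by rewrite (le_lt_trans (metric_triangle x y z))// ltrD2l.
Qed.

Lemma open_mball x r : open (ball x r).
Proof.
rewrite openE => y /ballP xy; rewrite /interior -nbhs_ballE.
exists (r - mdist x y) => /=; first by rewrite subr_gt0.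
by apply: subset_ball; rewrite addrC subrK.
Qed.

End balls.

Section doubling_balls.
Context (R : realType) (d : measure_display) (X : metricMeasurableType R d).
Variables (mu : {measure set X -> \bar R}).
Hypothesis open_measurable : forall U : set X, open U -> measurable U.
Implicit Types (x y z : X) (r s : R).

Definition vol x r : R := fine (mu (ball x r)).

Lemma measurable_mball x r : measurable (ball x r).
Proof. exact/open_measurable/open_mball. Qed.
Hint Resolve measurable_mball : core.

(** The doubling condition restated for the real-valued measures of balls. *)
Definition doubling_with (C : R) := [/\ 1 <= C,
  forall x r, 0 < r -> mu (ball x r) = (vol x r)%:E,
  forall x r, 0 < r -> 0 < vol x r &
  forall x r, 0 < r -> vol x (2 * r) <= C * vol x r].

Lemma doubling_withP (x0 : X) : doubling mu -> exists C, doubling_with C.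
Proof.
move=> [C C0 CP]; exists C.
have V x r : 0 < r -> mu (ball x r) = (vol x r)%:E.
  move=> r0; rewrite fineK// ge0_fin_numE//.
  have [_ _] := CP x r r0.
  case: (mu (ball x r)) (measure_ge0 mu (ball x r)) => [v _ _|_|//].
    exact: ltry.
  by rewrite mulry gtr0_sg// mul1e.
have Vgt0 x r : 0 < r -> 0 < vol x r.
  move=> r0; rewrite -lte_fin -V//.
  have r20 : 0 < r / 2 by rewrite divr_gt0.
  by have [] := CP x _ r20; rewrite mulrCA mulfV// mulr1.
have Vd x r : 0 < r -> vol x (2 * r) <= C * vol x r.
  by move=> r0; rewrite -lee_fin EFinM -!V ?mulr_gt0//; have [] := CP x r r0.
split => //; have := Vd x0 1 ltr01; rewrite mulr1 => h.
have : vol x0 1 <= vol x0 2.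
  rewrite -lee_fin -!V//; apply: le_measure; rewrite ?inE//.
  by apply: subset_ball; rewrite mdistxx add0r ler1n.
by move/le_trans => /(_ _ h); rewrite ler_pMl// Vgt0.
Qed.

Section with_constant.
Variable C : R.
Hypothesis CP : doubling_with C.

Lemma dbl_ge1 : 1 <= C. Proof. by case: CP. Qed.
Lemma dbl_gt0 : 0 < C. Proof. exact: lt_le_trans ltr01 dbl_ge1. Qed.
Lemma mu_ball x r : 0 < r -> mu (ball x r) = (vol x r)%:E.
Proof. by case: CP => _ + _ _; exact. Qed.
Lemma vol_gt0 x r : 0 < r -> 0 < vol x r.
Proof. by case: CP => _ _ + _; exact. Qed.

Lemma vol_subset x y r s : 0 < r -> mdist x y + r <= s -> vol y r <= vol x s.
Proof.
move=> r0 h; have s0 : 0 < s.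
  by rewrite (lt_le_trans _ h)// ltr_wpDl// mdist_ge0.
rewrite -lee_fin -!mu_ball//; apply: le_measure; rewrite ?inE//.
exact: subset_ball.
Qed.

Lemma vol_double n x r : 0 < r -> vol x (2 ^+ n * r) <= C ^+ n * vol x r.
Proof.
move=> r0; elim: n => [|n IH]; first by rewrite !mul1r.
rewrite !exprS -!mulrA; case: (CP) => _ _ _ h.
apply: le_trans (h _ _ _) _; first by rewrite mulr_gt0// exprn_gt0.
by rewrite ler_wpM2l// ltW// dbl_gt0.
Qed.

(** Doubling in the form in which it is used throughout: the measures of two
balls are comparable as soon as one of them covers the other after finitely
many doublings of the radius. *)
Lemma vol_comparable n x y r s : 0 < r -> 0 < s ->
  mdist x y + r <= 2 ^+ n * s -> vol y r <= C ^+ n * vol x s.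
Proof.
by move=> r0 s0 /(vol_subset r0)/le_trans; apply; exact: vol_double.
Qed.

(** A family of balls that are pairwise far apart and have measure at least
[c] each carries at least [c] times as much mass as it has members, so it is
finite whenever it lies in a set of finite measure. *)
Lemma separated_measure (e c : R) (s : seq X) (D : set X) :
  measurable D ->
  (forall x, x \in s -> ball x e `<=` D) ->
  (forall x, x \in s -> (c%:E <= mu (ball x e))%E) ->
  pairwise (fun x y => 2 * e <= mdist x y) s ->
  (((size s)%:R * c)%:E <= mu D)%E.
Proof.
elim: s D => [|x s IH] D mD sD sc; first by rewrite mul0r.
move=> /andP[/allP xs ps].
have mDx : measurable (D `\` ball x e) by exact: measurableD.
have -> : mu D = (mu (ball x e) + mu (D `\` ball x e))%E.
  rewrite -measureU//; last by rewrite setDE setICA setICr setI0.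
  by rewrite setDUK//; apply: sD; rewrite mem_head.
rewrite /= -natr1 mulrDl mul1r addrC EFinD leeD//.
  by apply: sc; rewrite mem_head.
apply: IH => // y ys; last by apply: sc; rewrite in_cons ys orbT.
move=> z yz; split; first by apply: sD yz; rewrite in_cons ys orbT.
move=> /ballP xz; have /= := xs y ys; rewrite leNgt => /negP; apply.
rewrite (le_lt_trans (metric_triangle x z y))// mulr_natl mulr2n ltrD//.
by rewrite metric_sym; exact/ballP.
Qed.

(** The doubling condition bounds the size of a separated subset of a ball, and
a separated subset of maximal size is a net. *)
Lemma finite_net (x0 : X) (rho e : R) : 0 < rho -> 0 < e -> exists s : seq X,
  forall x, ball x0 rho x -> exists2 y, y \in s & mdist x y < e.
Proof.
move=> rho0 e0.
pose P k := `[< exists s : seq X, [/\ size s = k,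
   (forall x, x \in s -> ball x0 rho x) &
   pairwise (fun x y => e <= mdist x y) s] >].
have e20 : 0 < e / 2 by rewrite divr_gt0.
have re0 : 0 < rho + e by rewrite addr_gt0.
have exP : exists k, P k by exists 0; apply/asboolP; exists [::].
have [n hn] : exists n, 2 * rho + e <= 2 ^+ n * (e / 2).
  exists (Num.truncn ((2 * rho + e) / (e / 2))).+1.
  rewrite -ler_pdivrMr//; apply: le_trans (ltW (truncnS_gt _)) _.
  by rewrite -natrX ler_nat ltnW// ltn_expl.
pose c := vol x0 (rho + e) / C ^+ n.
have c0 : 0 < c by rewrite divr_gt0// ?exprn_gt0// ?dbl_gt0// vol_gt0.
have ubP k : P k -> (k <= Num.truncn (vol x0 (rho + e) / c))%N.
  move=> /asboolP[s [<- sB ps]].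
  have : ((((size s)%:R * c)%:E <= mu (ball x0 (rho + e)))%E).
    apply: (@separated_measure (e / 2)) => //.
    - move=> x /sB/ballP x0x; apply: subset_ball; lra.
    - move=> x /sB/ballP x0x; rewrite mu_ball// lee_fin.
      rewrite ler_pdivrMr ?exprn_gt0 ?dbl_gt0// mulrC; apply: vol_comparable => //.
      rewrite metric_sym; lra.
    - apply: sub_pairwise ps => x y /=.
      by rewrite mulrCA mulfV// mulr1.
  rewrite mu_ball// lee_fin -ler_pdivlMr// => h.
  by rewrite truncn_ge_nat// (le_trans _ h).
case: (ex_maxnP exP ubP) => k /asboolP[s [sk sB ps]] kmax.
exists s => x Bx; apply: contrapT => nx.
have : P k.+1.
  apply/asboolP; exists (x :: s); split => /=; first by rewrite sk.
    by move=> y; rewrite in_cons => /predU1P[->//|/sB].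
  rewrite ps andbT; apply/allP => y ys /=; rewrite leNgt; apply/negP => xy.
  by apply: nx; exists y.
by move/kmax; rewrite ltnn.
Qed.

(** The dense sequence is made of finite nets: [(n, m, i)] is sent to the [i]-th
point of a net of mesh [m.+1^-1] in the ball of radius [n.+1]. *)
Lemma doubling_separable (x0 : X) : exists q : nat * nat * nat -> X,
  forall x e, 0 < e -> exists k, mdist x (q k) < e.
Proof.
have net (n m : nat) : {s : seq X | forall x, ball x0 n.+1%:R x ->
    exists2 y, y \in s & mdist x y < m.+1%:R^-1}.
  by apply/cid/finite_net => //; rewrite invr_gt0.
exists (fun k => nth x0 (sval (net k.1.1 k.1.2)) k.2) => x e e0.
pose n := Num.truncn (mdist x0 x); pose m := Num.truncn e^-1.
have [y ys xy] := svalP (net n m) x ((ballP _ _ _).2 (truncnS_gt _)).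
exists (n, m, index y (sval (net n m))); rewrite /= nth_index//.
apply: lt_trans xy _; rewrite invf_plt ?posrE//; exact: truncnS_gt.
Qed.

Lemma doubling_sigma_finite (x0 : X) : sigma_finite setT mu.
Proof.
exists (fun n => ball x0 n.+1%:R).
  apply/esym; rewrite -subTset => x _; exists (Num.truncn (mdist x0 x)) => //.
  exact/ballP/truncnS_gt.
by move=> n; split => //; rewrite mu_ball// ltry.
Qed.

(** Separability makes the product sigma-algebra large enough to contain the
open set [mdist x y < r], which is a countable union of products of balls. *)
Lemma measurable_dist_lt (r : R) : measurable [set q : X * X | mdist q.1 q.2 < r].
Proof.
have [->|/set0P[[x0 _] _]] := eqVneq [set q : X * X | mdist q.1 q.2 < r] set0.
  exact: measurable0.
have [q dq] := doubling_separable x0.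
have -> : [set u : X * X | mdist u.1 u.2 < r] =
    \bigcup_(k : (nat * nat * nat) * rat)
       (ball (q k.1) (ratr k.2) `*` ball (q k.1) (r - ratr k.2)).
  apply/seteqP; split=> [[x z] /= xz|[x z] /= [[k n] _ [/= /ballP yx /ballP yz]]];
    last first.
    rewrite (le_lt_trans (metric_triangle x (q k) z))//.
    by rewrite -(subrK (ratr n) r) addrC ltrD// metric_sym.
  have e0 : 0 < (r - mdist x z) / 2 by rewrite divr_gt0// subr_gt0.
  have [k xy] := dq x _ e0.
  have [n] := rat_in_itvoo xy.
  rewrite in_itv/= => /andP[n1 n2].
  exists (k, n) => //; split; apply/ballP => /=.
    by rewrite metric_sym.
  have := metric_triangle (q k) x z; rewrite (metric_sym (q k) x).
  lra.
apply: countable_bigcupT_measurable => // k.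
exact: measurableX.
Qed.

End with_constant.
End doubling_balls.

(** * The pointwise Lipschitz constant *)

Section pointwise_lipschitz.
Context (R : realType) (d : measure_display) (X : metricMeasurableType R d).
Implicit Types (x y z : X) (r s t : R) (f : X -> R).

Lemma locally_lipschitz_continuous f : locally_lipschitz f -> continuous f.
Proof.
move=> lf x; have [r [K [r0 h]]] := lf x.
apply/cvgrPdist_lt => e e0; apply/nbhs_ballP.
pose K1 := `|K| + 1; have K10 : 0 < K1 by rewrite ltr_wpDl.
exists (Num.min r (e / K1)) => /=; first by rewrite lt_min r0 divr_gt0.
move=> y /ballP; rewrite lt_min => /andP[yr ye] /=.
have := h x y; rewrite !ballP mdistxx => /(_ r0 yr)/le_lt_trans; apply.
move: ye; rewrite ltr_pdivlMr// => /(le_lt_trans _); apply.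
by rewrite mulrC ler_wpM2l ?mdist_ge0// /K1 (le_trans (ler_norm K))// lerDl.
Qed.

Lemma Lip_ge0 f y : (0 <= Lip f y)%E.
Proof.
apply: le_ereal_inf_tmp => _ [A FA <-].
have [r [Ar r0]] : exists r, A r /\ 0 < r.
  by apply: (@filter_ex _ (0 : R)^'+); apply: filterI => //; exact: nbhs_right_gt.
apply: le_ereal_sup_tmp; eexists; first by exists r; [exact: Ar|reflexivity].
apply: le_ereal_sup_tmp; exists ((`|f y - f y| / r)%:E).
  by exists y => //=; rewrite mdistxx ltW.
by rewrite subrr normr0 mul0r.
Qed.

Lemma Lip_le f y r (M : R) : 0 < r -> 0 <= M ->
  (forall x, mdist x y < r -> `|f x - f y| <= M * mdist x y) ->
  (Lip f y <= M%:E)%E.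
Proof.
move=> r0 M0 h; apply: ge_ereal_inf.
exists (ereal_sup ((fun r : R =>
    ereal_sup [set (`|f x - f y| / r)%:E | x in [set x | mdist x y <= r]]) @`
      [set s | 0 < s < r])).
  exists [set s | 0 < s < r] => //.
  near=> s; apply/andP; split; near: s; first exact: nbhs_right_gt.
  exact: nbhs_right_lt.
apply: ge_ereal_sup => _ [s /andP[s0 sr] <-].
apply: ge_ereal_sup => _ [x /= xs <-]; rewrite lee_fin ler_pdivrMr//.
by rewrite (le_trans (h _ (le_lt_trans xs sr)))// ler_wpM2l.
Unshelve. all: by end_near. Qed.

Section measurability.
Hypothesis open_measurable : forall U : set X, open U -> measurable U.

Lemma continuous_measurable f : continuous f -> measurable_fun setT f.
Proof.
move=> /continuousP cf; apply: (measurability _ (RGenOpens.measurableE R)).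
move=> _ [_ [a [b ->] <-]]; rewrite setTI; apply: open_measurable.
exact/cf/interval_open.
Qed.

(** The upper limit as [r] decreases to [0] is an infimum over [n] of suprema
over [r < n.+1^-1]; each of these is lower semicontinuous when [f] is
continuous, since a difference quotient that exceeds [a] does so for slightly
larger radii and for slightly moved centres. *)
Lemma measurable_Lip f : continuous f -> measurable_fun setT (Lip f).
Proof.
move=> cf.
pose quot y n := [set e | exists r x, [/\ 0 < r < n.+1%:R^-1, mdist x y <= r
  & e = (`|f x - f y| / r)%:E]].
pose T n y := ereal_sup (quot y n).
have mT n : measurable_fun setT (T n).
  apply: (measurability _ (ErealGenOInfty.measurableE R)).
  move=> _ [_ [a ->] <-]; rewrite setTI preimage_itvoy.
  apply: open_measurable; rewrite openE => y /=.
  rewrite /T => /ereal_sup_gt[_ [r [x [/andP[r0 rn] xy ->]]]].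
  rewrite lte_fin ltr_pdivlMr// => axy.
  have [s [rs sn axys]] : exists s,
      [/\ r < s, s < n.+1%:R^-1 & a * s < `|f x - f y|].
    have : \forall s \near r^'+,
        [/\ r < s, s < n.+1%:R^-1 & a * s < `|f x - f y|].
      near=> s; split; near: s; [exact: nbhs_right_gt|exact: nbhs_right_lt|].
      have : a * t @[t --> r^'+] --> a * r.
        exact/cvg_at_right_filter/mulrl_continuous.
      by move/cvgr_lt; exact.
    by move=> /filter_ex.
  have s0 : 0 < s by exact: lt_trans rs.
  have N1 : \forall z \near y, mdist x z < s.
    apply/nbhs_ballP; exists (s - mdist x y) => /=.
      by rewrite subr_gt0 (le_lt_trans xy).
    move=> z /ballP yz; rewrite (le_lt_trans (metric_triangle x y z))//; lra.
  have N2 : \forall z \near y, a * s < `|f x - f z|.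
    have : `|f x - f z| @[z --> y] --> `|f x - f y|.
      by apply: cvg_norm; apply: cvgB; [exact: cvg_cst|exact: cf].
    by move/cvgr_gt; exact.
  near=> z.
  apply: (@lt_le_trans _ _ (`|f x - f z| / s)%:E).
    by rewrite lte_fin ltr_pdivlMr//; near: z.
  apply: ereal_sup_ubound; exists s, x; split => //; first by rewrite s0.
  by apply: ltW; near: z.
rewrite (_ : Lip f = fun y => einfs (T ^~ y) 0).
  exact: measurable_fun_einfs.
apply/funext => y; rewrite /einfs; apply/eqP; rewrite eq_le; apply/andP; split.
  apply: le_ereal_inf_tmp => _ [n _ <-]; apply: ge_ereal_inf.
  eexists; first by exists [set s | 0 < s < n.+1%:R^-1] => //;
    near=> s; apply/andP; split; near: s;
    [exact: nbhs_right_gt|exact: nbhs_right_lt].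
  apply: ge_ereal_sup => _ [s /= sn <-]; apply: ge_ereal_sup => _ [x /= xs <-].
  by apply: ereal_sup_ubound; exists s, x; split => //.
apply: le_ereal_inf_tmp => _ [A [e /= e0 eA] <-].
pose n := Num.truncn e^-1.
have ne : n.+1%:R^-1 < e by rewrite invf_plt ?posrE//; exact: truncnS_gt.
apply: ge_ereal_inf; exists (T n y); first by exists n.
apply: ge_ereal_sup => _ [s [x [/andP[s0 sn] xy ->]]].
apply: le_ereal_sup_tmp; eexists.
  exists s; last by reflexivity.
  apply: eA => //=; rewrite sub0r normrN gtr0_norm//; exact: lt_trans ne.
by apply: ereal_sup_ubound; exists x.
Unshelve. all: by end_near. Qed.

End measurability.
End pointwise_lipschitz.

(** * Averages over pairs of nearby points *)

Section doubling_space.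
Context (R : realType) (d : measure_display) (X : metricMeasurableType R d).
Variable mu : {sigma_finite_measure set X -> \bar R}.
Hypothesis open_measurable : forall U : set X, open U -> measurable U.
Variable C : R.
Hypothesis CP : doubling_with mu C.
Implicit Types (x y z : X) (r s t : R).

Local Notation vol := (vol mu).
Let mball x r : measurable (ball x r). Proof. exact: measurable_mball. Qed.
Hint Resolve mball : core.
Let C0 : 0 < C. Proof. exact: dbl_gt0 CP. Qed.
Hint Resolve C0 : core.

Lemma indic_ball r x y : \1_(ball x r) y = (mdist x y < r)%R%:R :> R.
Proof.
rewrite indicE; congr (nat_of_bool _)%:R.
by apply/idP/idP => [/set_mem/ballP|/ballP ?]//; exact/mem_set.
Qed.

Lemma indic_ballC r x y : \1_(ball x r) y = \1_(ball y r) x :> R.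
Proof. by rewrite !indic_ball metric_sym. Qed.

Lemma measurable_indic_ball d' (T : measurableType d') (a b : T -> X) r :
  measurable_fun setT a -> measurable_fun setT b ->
  measurable_fun setT (fun u => \1_(ball (a u) r) (b u) : R).
Proof.
move=> ma mb.
rewrite (_ : (fun u => _) =
  (\1_[set q : X * X | mdist q.1 q.2 < r] : _ -> R) \o (fun u => (a u, b u))).
  apply: measurableT_comp; last exact: measurable_fun_pair.
  by apply: measurable_indic; exact: measurable_dist_lt CP _.
by apply/funext => u /=; rewrite indic_ball indicE mem_setE.
Qed.

Definition invvol r x := (vol x r)^-1.

Lemma invvol_ge0 r x : 0 <= invvol r x.
Proof. by rewrite invr_ge0 fine_ge0. Qed.

Lemma measurable_invvol r : measurable_fun setT (invvol r).
Proof.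
have -> : invvol r = (fun v => v `^ (-1)) \o vol ^~ r.
  by apply/funext => x /=; rewrite powR_inv1// fine_ge0.
apply: measurableT_comp; first exact: measurable_powR.
apply: measurableT_comp; first exact: fine_measurable.
have := @measurable_fun_xsection _ _ _ _ _ mu _
  (measurable_dist_lt open_measurable CP r).
congr measurable_fun; apply/funext => x /=; congr (mu _).
by apply/seteqP; split => y; rewrite /xsection/= ?inE/= => /ballP.
Qed.

Lemma integral_ballE x r (g : X -> \bar R) :
  (\int[mu]_(y in ball x r) g y = \int[mu]_y ((\1_(ball x r) y)%:E * g y))%E.
Proof.
rewrite integral_mkcond epatch_indic; apply: eq_integral => y _ /=.
exact: muleC.
Qed.

Lemma integral_indic_ball x r : 0 < r ->
  (\int[mu]_y (\1_(ball x r) y)%:E = (vol x r)%:E)%E.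
Proof. by move=> r0; rewrite integral_indic// setIT (mu_ball CP). Qed.

(** By Tonelli's theorem the left-hand side integrates [g y] against the measure
of [ball y t] for the density [invvol s]. This is at most [K], since [invvol s]
is at most [K / vol y t] on that ball. *)
Lemma integral_avg_le s t (K : R) (g : X -> \bar R) :
  0 < s -> 0 < t -> 0 < K -> measurable_fun setT g -> (forall y, 0 <= g y)%E ->
  (forall y z, mdist y z < t -> vol y t <= K * vol z s) ->
  (\int[mu]_z ((invvol s z)%:E * \int[mu]_(y in ball z t) g y) <=
   K%:E * \int[mu]_y g y)%E.
Proof.
move=> s0 t0 K0 mg g0 hK.
pose F z y := ((invvol s z * \1_(ball z t) y)%:E * g y)%E.
have F0 z y : (0 <= F z y)%E.
  by rewrite mule_ge0// lee_fin mulr_ge0// invvol_ge0.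
have mk : measurable_fun setT
   (fun u : X * X => (invvol s u.1 * \1_(ball u.1 t) u.2)%:E).
  apply/measurable_EFinP/measurable_funM.
    exact: (measurableT_comp (measurable_invvol s)).
  exact: measurable_indic_ball.
have mF : measurable_fun setT (fun u : X * X => F u.1 u.2).
  by apply: emeasurable_funM => //; exact: measurableT_comp.
have -> : (\int[mu]_z ((invvol s z)%:E * \int[mu]_(y in ball z t) g y) =
    \int[mu]_z \int[mu]_y F z y)%E.
  apply: eq_integral => z _; rewrite integral_ballE -ge0_integralZl//.
  - by apply: eq_integral => y _; rewrite muleA.
  - apply: emeasurable_funM => //; apply/measurable_EFinP.
    exact: measurable_indic_ball.
  - by move=> y _; rewrite mule_ge0.
  - by rewrite lee_fin invvol_ge0.
rewrite (fubini_tonelli (fun u => F u.1 u.2))//=.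
rewrite -ge0_integralZl//=; last by rewrite lee_fin ltW.
apply: ge0_le_integral => //=.
- by move=> y _; exact: integral_ge0.
- exact: (measurable_fun_fubini_tonelli_G (fun u => F u.1 u.2)).
- by apply: emeasurable_funM.
move=> y _; rewrite ge0_integralZr//=; last first.
- by move=> z _; rewrite lee_fin mulr_ge0// invvol_ge0.
- exact: (measurableT_comp mk (measurable_fun_pair _ _)).
apply: lee_wpmul2r => //.
have vy : 0 < vol y t by exact: (vol_gt0 CP).
apply: (@le_trans _ _ (\int[mu]_z ((K / vol y t)%:E * (\1_(ball y t) z)%:E))%E).
  apply: ge0_le_integral => //=.
  - by move=> z _; rewrite lee_fin mulr_ge0// invvol_ge0.
  - exact: (measurableT_comp mk (measurable_fun_pair _ _)).
  - apply: emeasurable_funM => //; apply/measurable_EFinP.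
    exact: measurable_indic_ball.
  move=> z _; rewrite -EFinM lee_fin indic_ballC indic_ball.
  have [yz|_] := ltP; last by rewrite !mulr0.
  rewrite !mulr1 ler_pdivlMr// mulrC ler_pdivrMr ?(vol_gt0 CP)//.
  exact: hK.
rewrite ge0_integralZl//.
- by rewrite integral_indic_ball// -EFinM divfK// gt_eqF.
- by apply/measurable_EFinP; exact: measurable_indic_ball.
- by rewrite lee_fin divr_ge0// ltW.
Qed.

Section pair_averages.
Implicit Type g : X * X -> \bar R.

Let mindic d' (T : measurableType d') (a b : T -> X) r :
  measurable_fun setT a -> measurable_fun setT b ->
  measurable_fun setT (fun u => \1_(ball (a u) r) (b u) : R).
Proof. by move=> ma mb; exact: measurable_indic_ball. Qed.
Let minvvol d' (T : measurableType d') (a : T -> X) r :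
  measurable_fun setT a -> measurable_fun setT (fun u => invvol r (a u)).
Proof.
by move=> ma; exact: (measurableT_comp (measurable_invvol r)).
Qed.

(** The variable [z] is moved first past [x] and then past [y], so that only [mu]
itself has to be sigma-finite. *)
Let tonelli3 (F : X * (X * X) -> \bar R) :
  measurable_fun setT F -> (forall u, 0 <= F u)%E ->
  (\int[mu]_z \int[mu \x mu]_q F (z, q) =
   \int[mu \x mu]_q \int[mu]_z F (z, q))%E.
Proof.
move=> mF F0.
have mG : measurable_fun setT (fun q => \int[mu]_z F (z, q))%E.
  exact: measurable_fun_fubini_tonelli_G.
rewrite [RHS]fubini_tonelli1//; last by move=> q; exact: integral_ge0.
have mFz z : measurable_fun setT (fun q => F (z, q)) by exact: measurableT_comp.
under eq_integral => z _ do rewrite (fubini_tonelli1 (fun q => F (z, q)))//.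
have mH : measurable_fun setT (fun v : X * X => \int[mu]_y F (v.1, (v.2, y)))%E.
  apply: (measurable_fun_fubini_tonelli_F
    (fun w : (X * X) * X => F (w.1.1, (w.1.2, w.2)))) => //.
  apply: measurableT_comp => //; apply: measurable_fun_pair => /=.
    exact: measurableT_comp.
  by apply: measurable_fun_pair => //; exact: measurableT_comp.
pose G v := (\int[mu]_y F (v.1, (v.2, y)))%E.
have G0 (v : X * X) : (0 <= G v)%E by exact: integral_ge0.
transitivity (\int[mu]_x \int[mu]_z G (z, x))%E.
  exact: (fubini_tonelli G mH G0).
apply: eq_integral => x _.
pose H v := F (v.1, (x, v.2)).
have mHx : measurable_fun setT H.
  apply: measurableT_comp => //; apply: measurable_fun_pair => //.
  exact: measurable_fun_pair.
exact: (fubini_tonelli H mHx (fun=> F0 _)).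
Qed.

Definition near_avg r g : \bar R :=
  (\int[mu]_x ((invvol r x)%:E * \int[mu]_(y in ball x r) g (x, y)))%E.

(** Here the two points range independently over a ball, so that they can be
compared through a third value, such as the mean of a function on that ball. *)
Definition ball_avg r g : \bar R :=
  (\int[mu]_z ((invvol r z ^+ 2)%:E *
     \int[mu]_(x in ball z r) \int[mu]_(y in ball z r) g (x, y)))%E.

(* the weights of the pair [q] in the averages [near_avg] and [ball_avg] *)
Let k1 r (q : X * X) : R := invvol r q.1 * \1_(ball q.1 r) q.2.
Let k2 r z (q : X * X) : R :=
  invvol r z ^+ 2 * (\1_(ball z r) q.1 * \1_(ball z r) q.2).

Let k1_ge0 r q : 0 <= k1 r q.
Proof. by rewrite mulr_ge0// invvol_ge0. Qed.
Let k2_ge0 r z q : 0 <= k2 r z q.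
Proof. by apply: mulr_ge0; [exact: sqr_ge0|exact: mulr_ge0]. Qed.
Let mk1 r : measurable_fun setT (fun q => (k1 r q)%:E).
Proof. by apply/measurable_EFinP/measurable_funM; [exact: minvvol|exact: mindic]. Qed.
Let mk2 r : measurable_fun setT (fun u : X * (X * X) => (k2 r u.1 u.2)%:E).
Proof.
apply/measurable_EFinP/measurable_funM; first exact/measurable_funX/minvvol.
by apply: measurable_funM; apply: mindic => //; exact: measurableT_comp.
Qed.

Section fixed_integrand.
Variable g : X * X -> \bar R.
Hypotheses (mg : measurable_fun setT g) (g0 : forall q, (0 <= g q)%E).

Let mgx x : measurable_fun setT (fun y => g (x, y)).
Proof. exact: measurableT_comp. Qed.

Lemma near_avgE r : (near_avg r g = \int[mu \x mu]_q ((k1 r q)%:E * g q))%E.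
Proof.
rewrite fubini_tonelli1//; last 2 first.
- exact: emeasurable_funM.
- by move=> q; rewrite mule_ge0// lee_fin.
apply: eq_integral => x _; rewrite /fubini_F integral_ballE -ge0_integralZl//.
- by apply: eq_integral => y _; rewrite muleA.
- by apply: emeasurable_funM => //; apply/measurable_EFinP/mindic.
- by move=> y _; rewrite mule_ge0.
- by rewrite lee_fin invvol_ge0.
Qed.

Lemma ball_avgE r :
  (ball_avg r g = \int[mu \x mu]_q ((\int[mu]_z (k2 r z q)%:E) * g q))%E.
Proof.
pose F (u : X * (X * X)) := ((k2 r u.1 u.2)%:E * g u.2)%E.
have mF : measurable_fun setT F.
  by apply: emeasurable_funM => //; exact: measurableT_comp.
have F0 u : (0 <= F u)%E by rewrite mule_ge0// lee_fin.
transitivity (\int[mu]_z \int[mu \x mu]_q F (z, q))%E; last first.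
  rewrite tonelli3//.
  apply: eq_integral => q _.
  rewrite /F/= ge0_integralZr//; last by move=> z _; rewrite lee_fin.
  exact: (measurableT_comp (mk2 r) (measurable_fun_pair _ _)).
apply: eq_integral => z _.
have mFz : measurable_fun setT (fun q => F (z, q)) by exact: measurableT_comp.
rewrite fubini_tonelli1//.
have m1 x : measurable_fun setT (fun y => (\1_(ball z r) y)%:E * g (x, y))%E.
  by apply: emeasurable_funM => //; apply/measurable_EFinP/mindic.
have m2 : measurable_fun setT (fun x => (\1_(ball z r) x)%:E *
    \int[mu]_(y in ball z r) g (x, y))%E.
  apply: emeasurable_funM; first exact/measurable_EFinP/mindic.
  under eq_fun do rewrite integral_ballE.
  apply: (measurable_fun_fubini_tonelli_F
    (fun q => (\1_(ball z r) q.2)%:E * g q)%E) => //.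
    by apply: emeasurable_funM => //; apply/measurable_EFinP/mindic.
  by move=> q; rewrite mule_ge0.
have h0 x : (0 <= (\1_(ball z r) x)%:E * \int[mu]_(y in ball z r) g (x, y))%E.
  by rewrite mule_ge0// integral_ge0.
rewrite integral_ballE -ge0_integralZl//; last by rewrite lee_fin sqr_ge0.
apply: eq_integral => x _; rewrite /fubini_F integral_ballE.
rewrite -ge0_integralZl//; last by move=> y _; rewrite mule_ge0.
rewrite -ge0_integralZl//; last by rewrite lee_fin sqr_ge0.
- by apply: eq_integral => y _; rewrite /F /k2/= !muleA -!EFinM !mulrA.
- by apply: emeasurable_funM.
- by move=> y _; rewrite mule_ge0// mule_ge0.
Qed.

Let mintk2 r : measurable_fun setT (fun q => \int[mu]_z (k2 r z q)%:E)%E.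
Proof.
apply: (measurable_fun_fubini_tonelli_G
  (fun u : X * (X * X) => (k2 r u.1 u.2)%:E)) => // u.
by rewrite lee_fin.
Qed.

Let mk2z r q : measurable_fun setT (fun z => (k2 r z q)%:E).
Proof. exact: (measurableT_comp (mk2 r) (measurable_fun_pair _ _)). Qed.

(** Two points of a ball of radius [r] are less than [2 * r] apart; integrating
over the centre of the ball, of which there is only a ball's worth, turns the
average over pairs in balls into an average over pairs of nearby points. *)
Lemma ball_avg_le r : 0 < r ->
  (ball_avg r g <= (C ^+ 4)%:E * near_avg (2 * r) g)%E.
Proof.
move=> r0; rewrite ball_avgE near_avgE -ge0_integralZl//; last 3 first.
- exact: emeasurable_funM.
- by move=> q _; rewrite mule_ge0// lee_fin.
- by rewrite lee_fin exprn_ge0// ltW.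
have r20 : 0 < 2 * r by rewrite mulr_gt0.
apply: ge0_le_integral => //.
- by move=> q _; rewrite mule_ge0// integral_ge0// => z _; rewrite lee_fin.
- exact: emeasurable_funM.
- by apply: emeasurable_funM => //; apply: emeasurable_funM.
move=> [x y] _; rewrite muleA lee_wpmul2r// -EFinM.
have vx : 0 < vol x (2 * r) by exact: (vol_gt0 CP).
apply: (@le_trans _ _ (\int[mu]_z
   ((C ^+ 4 * (vol x (2 * r))^-1 ^+ 2 * \1_(ball x (2 * r)) y)%:E *
      (\1_(ball x r) z)%:E))%E).
  apply: ge0_le_integral => //.
  - by move=> z _; rewrite lee_fin.
  - by apply: emeasurable_funM => //; apply/measurable_EFinP/mindic.
  have nn : 0 <= C ^+ 4 * (vol x (2 * r))^-1 ^+ 2.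
    by apply: mulr_ge0; [exact/exprn_ge0/ltW|exact: sqr_ge0].
  move=> z _; rewrite lee_fin /k2/= (indic_ballC r x z) !indic_ball.
  have [zx|_] := ltP; last by rewrite !mul0r !mulr0.
  have [zy|_] := ltP; last first.
    by rewrite !mulr0; do !apply: mulr_ge0 => //.
  have -> : mdist x y < 2 * r.
    rewrite (le_lt_trans (metric_triangle x z y))// metric_sym mulr_natl mulr2n.
    exact: ltrD.
  rewrite !mulr1 (exprM C 2 2) -exprMn ler_sqr ?nnegrE ?invvol_ge0//; last first.
    by apply: mulr_ge0; [exact/exprn_ge0/ltW|rewrite invr_ge0 ltW].
  rewrite ler_pdivlMr// mulrC ler_pdivrMr ?(vol_gt0 CP)//.
  apply: (vol_comparable open_measurable CP) => //.
  by lra.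
rewrite ge0_integralZl//; last 2 first.
- exact/measurable_EFinP/mindic.
- by rewrite lee_fin !mulr_ge0// ?exprn_ge0// ?invr_ge0 ltW.
rewrite integral_indic_ball// -EFinM lee_fin.
rewrite [leLHS](_ : _ = C ^+ 4 * k1 (2 * r) (x, y) * (vol x r / vol x (2 * r))).
  apply: ler_piMr; first by apply: mulr_ge0; [exact/exprn_ge0/ltW|exact: k1_ge0].
  rewrite ler_pdivrMr// mul1r.
  by apply: (vol_subset open_measurable CP) => //; rewrite mdistxx; lra.
rewrite /k1 /invvol/=; ring.
Qed.

(** Conversely, two points less than [r] apart both lie in the ball of radius
[2 * r] around every point of [ball x r]. *)
Lemma near_avg_le r : 0 < r ->
  (near_avg r g <= (C ^+ 4)%:E * ball_avg (2 * r) g)%E.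
Proof.
move=> r0; rewrite ball_avgE near_avgE -ge0_integralZl//; last 3 first.
- exact: emeasurable_funM.
- by move=> q _; rewrite mule_ge0// integral_ge0// => z _; rewrite lee_fin.
- by rewrite lee_fin exprn_ge0// ltW.
have r20 : 0 < 2 * r by rewrite mulr_gt0.
apply: ge0_le_integral => //.
- by move=> q _; rewrite mule_ge0// lee_fin.
- exact: emeasurable_funM.
- by apply: emeasurable_funM => //; apply: emeasurable_funM.
move=> [x y] _; rewrite muleA lee_wpmul2r//.
have vx : 0 < vol x r by exact: (vol_gt0 CP).
rewrite -ge0_integralZl//; last 2 first.
- by move=> z _; rewrite lee_fin.
- by rewrite lee_fin exprn_ge0// ltW.
apply: (@le_trans _ _ (\int[mu]_z
   (((vol x r)^-1 ^+ 2 * \1_(ball x r) y)%:E *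
      (\1_(ball x r) z)%:E))%E); last first.
  apply: ge0_le_integral => //.
  - by move=> z _; rewrite lee_fin !mulr_ge0// ?invr_ge0 ltW.
  - by apply: emeasurable_funM => //; apply/measurable_EFinP/mindic.
  - exact: emeasurable_funM.
  move=> z _; rewrite -!EFinM lee_fin.
  have nn : 0 <= C ^+ 4 * k2 (2 * r) z (x, y).
    by apply: mulr_ge0 => //; exact/exprn_ge0/ltW.
  have [xy|xy] := ltP (mdist x y) r; last first.
    by rewrite indic_ball (le_gtF xy) mulr0 mul0r.
  have [zx|zx] := ltP (mdist x z) r; last first.
    by rewrite (indic_ball r x z) (le_gtF zx) mulr0.
  rewrite /k2/= !indic_ball xy zx.
  have -> : mdist z x < 2 * r by rewrite metric_sym; lra.
  have -> : mdist z y < 2 * r.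
    by have := metric_triangle z x y; rewrite (metric_sym z x); lra.
  rewrite !mulr1 (exprM C 2 2) -exprMn ler_sqr ?nnegrE ?invr_ge0 ?(ltW vx)//;
    last first.
    by apply: mulr_ge0; [exact/exprn_ge0/ltW|exact: invvol_ge0].
  rewrite ler_pdivlMr ?(vol_gt0 CP)// mulrC ler_pdivrMr//.
  apply: (vol_comparable open_measurable CP) => //.
  by lra.
rewrite ge0_integralZl//; last 2 first.
- exact/measurable_EFinP/mindic.
- by rewrite lee_fin !mulr_ge0// ?exprn_ge0// ?invr_ge0 ltW.
rewrite integral_indic_ball// -EFinM lee_fin /k1 /invvol/=.
by rewrite expr2 mulrAC -(mulrA _ _ (vol x r)) mulVf ?gt_eqF// mulr1.
Qed.

End fixed_integrand.

End pair_averages.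

(** * Energies and the Poincare inequality *)

Variable p : R.
Hypothesis p1 : 1 <= p.
Implicit Types (c : R) (f g : X -> R).

Let p0 : 0 < p. Proof. exact: lt_le_trans p1. Qed.
Hint Resolve p0 : core.
Let mpow d' (T : measurableType d') (h : T -> R) :
  measurable_fun setT h -> measurable_fun setT (fun u => (h u `^ p)%:E).
Proof.
by move=> mh; apply/measurable_EFinP; exact: (measurableT_comp (measurable_powR p)).
Qed.
Let mabs d' (T : measurableType d') (h : T -> R) :
  measurable_fun setT h -> measurable_fun setT (fun u => (`|h u| `^ p)%:E).
Proof. by move=> mh; apply: mpow; exact: measurableT_comp. Qed.

Let miv r : measurable_fun setT (fun z => (invvol r z)%:E).
Proof. exact/measurable_EFinP/measurable_invvol. Qed.
Let iv0 r z : (0 <= (invvol r z)%:E)%E. Proof. by rewrite lee_fin invvol_ge0. Qed.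
Hint Extern 0 (is_true (_ <= (invvol _ _)%:E)%E) => exact: iv0 : core.

Lemma measurable_integral_ball d' (T : measurableType d') (a : T -> X)
    (G : T * X -> \bar R) r :
  measurable_fun setT a -> measurable_fun setT G -> (forall u, 0 <= G u)%E ->
  measurable_fun setT (fun t : T => \int[mu]_(y in ball (a t) r) G (t, y))%E.
Proof.
move=> ma mG G0; under eq_fun do rewrite integral_ballE.
apply: (measurable_fun_fubini_tonelli_F
  (fun u => (\1_(ball (a u.1) r) u.2)%:E * G u)%E) => /=.
  apply: emeasurable_funM => //; apply/measurable_EFinP.
  apply: measurable_indic_ball => //.
  exact: measurableT_comp.
by move=> u; rewrite mule_ge0.
Qed.

Definition osc f (q : X * X) : \bar R := (`|f q.2 - f q.1| `^ p)%:E.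

Lemma osc_ge0 f q : (0 <= osc f q)%E.
Proof. by rewrite lee_fin powR_ge0. Qed.
Hint Extern 0 (is_true (_ <= osc _ _)%E) => exact: osc_ge0 : core.

Lemma measurable_osc f : measurable_fun setT f -> measurable_fun setT (osc f).
Proof.
by move=> mf; apply: mabs; apply: measurable_funB; exact: measurableT_comp.
Qed.

Lemma measurable_near_integral f r : measurable_fun setT f ->
  measurable_fun setT (fun x => \int[mu]_(y in ball x r) osc f (x, y))%E.
Proof.
by move=> mf; apply: measurable_integral_ball => //; exact: measurable_osc.
Qed.

Lemma E_near_avg alpha f r : measurable_fun setT f -> 0 < r ->
  (E mu p alpha f r = ((r `^ (p * alpha))^-1)%:E * near_avg r (osc f))%E.
Proof.
move=> mf r0; rewrite /E /near_avg.
rewrite -ge0_integralZl//; last 3 first.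
- apply: emeasurable_funM; last exact: measurable_near_integral.
  exact/measurable_EFinP/measurable_invvol.
- by move=> x _; rewrite mule_ge0 ?integral_ge0// lee_fin invvol_ge0.
- by rewrite lee_fin invr_ge0 powR_ge0.
apply: eq_integral => x _.
rewrite (mu_ball CP)// inver gt_eqF ?(vol_gt0 CP)// muleCA; congr (_ * _)%E.
rewrite -ge0_integralZl//.
- by apply: eq_integral => y _; rewrite /osc/= -EFinM mulrC.
- apply: measurable_funTS.
  exact: (measurableT_comp (measurable_osc mf) (measurable_fun_pair _ _)).
- by rewrite lee_fin invr_ge0 powR_ge0.
Qed.

(** Both points are compared with [c]; in the Poincare inequality, [c] is the mean
of [f] on the ball. *)
Lemma ball_osc_le f c z r : measurable_fun setT f -> 0 < r ->
  (\int[mu]_(x in ball z r) \int[mu]_(y in ball z r) osc f (x, y) <=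
   (2 * 3 `^ p * vol z r)%:E * \int[mu]_(y in ball z r) (`|f y - c| `^ p)%:E)%E.
Proof.
move=> mf r0; pose J := (\int[mu]_(y in ball z r) (`|f y - c| `^ p)%:E)%E.
have J0 : (0 <= J)%E by apply: integral_ge0 => y _; rewrite lee_fin powR_ge0.
have mD : measurable_fun setT (fun y => (`|f y - c| `^ p)%:E).
  by apply: mabs; exact: measurable_funB.
have v0 := vol_gt0 CP z r0.
have a0 : (0 <= (3 `^ p)%:E)%E by rewrite lee_fin powR_ge0.
have h x : (\int[mu]_(y in ball z r) osc f (x, y) <=
    (3 `^ p)%:E * (J + (vol z r)%:E * (`|f x - c| `^ p)%:E))%E.
  have e k : ((vol z r)%:E * k = \int[mu]_(y in ball z r) cst k y)%E.
    by rewrite integral_cst// (mu_ball CP)// muleC.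
  rewrite e -ge0_integralD//; last 2 first.
  - exact: measurable_funTS.
  - by move=> y _; rewrite /= lee_fin powR_ge0.
  rewrite /= -ge0_integralZl//; last 2 first.
  - by apply: emeasurable_funD => //; exact: measurable_funTS.
  - by move=> y _; rewrite -EFinD lee_fin addr_ge0// powR_ge0.
  apply: ge0_le_integral => //.
  - apply: measurable_funTS.
    exact: (measurableT_comp (measurable_osc mf) (measurable_fun_pair _ _)).
  - apply: measurable_funTS; apply: emeasurable_funM => //.
    exact: emeasurable_funD.
  by move=> y _; rewrite -EFinD -EFinM lee_fin; exact: powR_dist_le.
apply: (@le_trans _ _ (\int[mu]_(x in ball z r)
    ((3 `^ p)%:E * (J + (vol z r)%:E * (`|f x - c| `^ p)%:E)))%E).
  apply: ge0_le_integral; first exact: mball.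
  - by move=> x _; exact: integral_ge0.
  - apply: measurable_funTS; apply: (@measurable_integral_ball _ _ (cst z)) => //.
    exact: measurable_osc.
  - apply: measurable_funTS; apply: emeasurable_funM => //.
    by apply: emeasurable_funD => //; exact: emeasurable_funM.
  - by move=> x _; exact: h.
have nn x : (0 <= (vol z r)%:E * (`|f x - c| `^ p)%:E)%E.
  by rewrite -EFinM lee_fin mulr_ge0 ?powR_ge0 ?ltW.
rewrite ge0_integralZl//; last 2 first.
- apply: measurable_funTS.
  by apply: emeasurable_funD => //; exact: emeasurable_funM.
- by move=> x _; rewrite adde_ge0.
rewrite ge0_integralD//; last first.
  by apply: measurable_funTS; exact: emeasurable_funM.
rewrite integral_cst// ge0_integralZl//; last 2 first.
- exact: measurable_funTS.
- by rewrite lee_fin ltW.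
rewrite (mu_ball CP)// (muleC J) -ge0_muleDl ?lee_fin ?(ltW v0)// -EFinD muleA -EFinM.
by rewrite (_ : 3 `^ p * _ = 2 * 3 `^ p * vol z r)//; ring.
Qed.

Lemma measurable_ball_integral f r : measurable_fun setT f ->
  measurable_fun setT (fun z => (invvol r z ^+ 2)%:E *
    \int[mu]_(x in ball z r) \int[mu]_(y in ball z r) osc f (x, y))%E.
Proof.
move=> mf; apply: emeasurable_funM.
  apply/measurable_EFinP/measurable_funX.
  exact: measurable_invvol.
apply: (@measurable_integral_ball _ _ id
  (fun u => \int[mu]_(y in ball u.1 r) osc f (u.2, y))%E) => //=; last first.
  by move=> u; exact: integral_ge0.
apply: (@measurable_integral_ball _ _ fst (fun v => osc f (v.1.2, v.2))) => //=.
apply: (measurableT_comp (measurable_osc mf)).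
by apply: measurable_fun_pair => //; exact: measurableT_comp.
Qed.

(** The Poincare inequality bounds the oscillation of [g] in each ball by its
local Lipschitz constant in a larger ball; averaging over all balls of a given
radius, the doubling condition absorbs the enlargement. *)
Lemma near_avg_le_Lip : poincare mu p -> exists2 K, 0 < K &
  forall g r, locally_lipschitz g -> 0 < r ->
  (near_avg r (osc g) <= (K * r `^ p)%:E * \int[mu]_y (Lip g y `^ p))%E.
Proof.
move=> [Cp [lam [Cp0 lam1 PI]]].
have [n hn] : exists n, 2 * lam <= 2 ^+ n.
  exists (Num.truncn (2 * lam)).+1; apply: le_trans (ltW (truncnS_gt _)) _.
  by rewrite -natrX ler_nat ltnW// ltn_expl.
have lam0 : 0 < lam by exact: lt_le_trans lam1.
have Cn0 m : 0 < C ^+ m by exact: exprn_gt0.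
have c3 : 0 < (3 : R) `^ p by exact: powR_gt0.
have c2 : 0 < (2 : R) `^ p by exact: powR_gt0.
pose K := C ^+ 4 * (2 * 3 `^ p * Cp * 2 `^ p * C ^+ n).
exists K; first by rewrite /K !mulr_gt0.
move=> g r lg r0.
have cg := locally_lipschitz_continuous lg.
have mg : measurable_fun setT g by exact: continuous_measurable.
have mL : measurable_fun setT (fun y => Lip g y `^ p)%E.
  apply: (measurableT_comp (measurable_poweR p)); exact: measurable_Lip.
have L0 y : (0 <= Lip g y `^ p)%E by exact: poweR_ge0.
have r20 : 0 < 2 * r by exact: mulr_gt0.
have rp0 : 0 < r `^ p by exact: powR_gt0.
apply: (le_trans (near_avg_le (measurable_osc mg) _ r0)) => //.
rewrite (_ : K * _ = C ^+ 4 * (K / C ^+ 4 * r `^ p)); last first.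
  by field; rewrite gt_eqF.
rewrite (EFinM (C ^+ 4)) -muleA; apply: lee_wpmul2l; first by rewrite lee_fin ltW.
pose M := 2 * 3 `^ p * Cp * (2 * r) `^ p.
have M0 : 0 < M by rewrite !mulr_gt0// powR_gt0.
have t0 : 0 < lam * (2 * r) by exact: mulr_gt0.
have mLz : measurable_fun setT
    (fun z => \int[mu]_(y in ball z (lam * (2 * r))) (Lip g y `^ p))%E.
  apply: (@measurable_integral_ball _ _ id (fun u => Lip g u.2 `^ p)%E) => //=.
  exact: (measurableT_comp mL measurable_snd).
apply: (@le_trans _ _ (\int[mu]_z (M%:E * ((invvol (2 * r) z)%:E *
    \int[mu]_(y in ball z (lam * (2 * r))) (Lip g y `^ p))))%E).
  apply: ge0_le_integral => //.
  - move=> z _; rewrite mule_ge0 ?lee_fin ?sqr_ge0// integral_ge0// => x _.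
    exact: integral_ge0.
  - exact: measurable_ball_integral.
  - by apply: emeasurable_funM => //; exact: emeasurable_funM.
  move=> z _; have v0 := vol_gt0 CP z r20.
  apply: (@le_trans _ _ ((invvol (2 * r) z ^+ 2)%:E *
      ((2 * 3 `^ p * vol z (2 * r))%:E * ((Cp * (2 * r) `^ p)%:E *
       \int[mu]_(y in ball z (lam * (2 * r))) (Lip g y `^ p))))%E).
    apply: lee_wpmul2l; first by rewrite lee_fin sqr_ge0.
    apply: (le_trans (ball_osc_le (mean mu g (ball z (2 * r))) z mg r20)).
    apply: lee_wpmul2l; first by rewrite lee_fin !mulr_ge0 ?ltW.
    exact: PI.
  rewrite !muleA -!EFinM le_eqVlt; apply/orP; left; apply/eqP.
  congr (_%:E * _)%E; rewrite /M /invvol; field; exact: lt0r_neq0.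
rewrite ge0_integralZl//; last 3 first.
- exact: emeasurable_funM.
- by move=> z _; rewrite mule_ge0// integral_ge0.
- by rewrite lee_fin ltW.
apply: (@le_trans _ _ (M%:E * ((C ^+ n)%:E * \int[mu]_y (Lip g y `^ p)))%E).
  apply: lee_wpmul2l; first by rewrite lee_fin ltW.
  apply: integral_avg_le => // y z yz.
  apply: (vol_comparable open_measurable CP) => //.
  have := ler_wpM2r (ltW r20) hn; apply: le_trans.
  by rewrite metric_sym; lra.
rewrite muleA -EFinM le_eqVlt; apply/orP; left; apply/eqP.
congr (_%:E * _)%E; rewrite /M /K powRM ?ltW//; field.
by rewrite gt_eqF.
Qed.

(** * Stability of the energies under local convergence *)

(** The difference [f y - f x] is split at [g x] and [g y], and [integral_avg_le]
turns the average of the error at [y] into its integral. The left-hand side is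
restricted to a ball because [g] need only be close to [f] on bounded sets. *)
Lemma near_avg_ball_perturb f g x0 rho r :
  measurable_fun setT f -> measurable_fun setT g -> 0 < rho -> 0 < r ->
  (\int[mu]_(x in ball x0 rho)
      ((invvol r x)%:E * \int[mu]_(y in ball x r) osc f (x, y)) <=
   (3 `^ p)%:E * ((1 + C)%:E *
      \int[mu]_(y in ball x0 (rho + r)) (`|g y - f y| `^ p)%:E
      + near_avg r (osc g)))%E.
Proof.
move=> mf mg rho0 r0.
pose D' := ball x0 (rho + r).
pose a y := (`|g y - f y| `^ p)%:E.
pose h y := ((\1_D' y)%:E * a y)%E.
have ma : measurable_fun setT a by apply: mabs; exact: measurable_funB.
have mh : measurable_fun setT h.
  by apply: emeasurable_funM => //; exact/measurable_EFinP/measurable_indic/mball.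
have a0 y : (0 <= a y)%E by rewrite lee_fin powR_ge0.
have h0 y : (0 <= h y)%E by rewrite mule_ge0.
have mhx : measurable_fun setT (fun x => \int[mu]_(y in ball x r) h y)%E.
  apply: (@measurable_integral_ball _ _ id
    (fun u => h u.2)) => //=.
  exact: (measurableT_comp mh measurable_snd).
have c0 : (0 <= (3 `^ p)%:E)%E by rewrite lee_fin powR_ge0.
have osc0 x : (0 <= \int[mu]_(y in ball x r) osc g (x, y))%E by exact: integral_ge0.
have hx0 x : (0 <= \int[mu]_(y in ball x r) h y)%E by exact: integral_ge0.
have pt x : ball x0 rho x ->
    ((invvol r x)%:E * \int[mu]_(y in ball x r) osc f (x, y) <=
     (3 `^ p)%:E * (a x + (invvol r x)%:E * \int[mu]_(y in ball x r) osc g (x, y)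
        + (invvol r x)%:E * \int[mu]_(y in ball x r) h y))%E.
  move=> Dx; have v0 := vol_gt0 CP x r0.
  have mgx : measurable_fun (ball x r) (fun y => osc g (x, y)).
    apply: measurable_funTS.
    exact: (measurableT_comp (measurable_osc mg) (measurable_fun_pair _ _)).
  (* the error at [x] is written as an average over [ball x r] as well *)
  have -> : (a x = (invvol r x)%:E * \int[mu]_(y in ball x r) cst (a x) y)%E.
    rewrite integral_cst// (mu_ball CP)// (muleC (a x)) muleA -(EFinM (invvol r x)).
    by rewrite mulVf ?gt_eqF// mul1e.
  have ca0 : (0 <= \int[mu]_(y in ball x r) cst (a x) y)%E.
    by apply: integral_ge0 => y _ /=.
  rewrite -(ge0_muleDr _ ca0 (osc0 x)).
  rewrite -(ge0_muleDr _ (adde_ge0 ca0 (osc0 x)) (hx0 x)).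
  rewrite muleCA; apply: lee_wpmul2l => //.
  have mha : measurable_fun (ball x r) h by exact: measurable_funTS.
  have ac0 y : (0 <= cst (a x) y)%E by exact: a0.
  rewrite -ge0_integralD// -ge0_integralD//; last 2 first.
  - by move=> y _; rewrite adde_ge0.
  - exact: emeasurable_funD.
  rewrite -ge0_integralZl//; last 2 first.
  - by apply: emeasurable_funD => //; exact: emeasurable_funD.
  - by move=> y _; rewrite !adde_ge0.
  apply: ge0_le_integral => //.
  - apply: measurable_funTS.
    exact: (measurableT_comp (measurable_osc mf) (measurable_fun_pair _ _)).
  - apply: emeasurable_funM => //.
    by apply: emeasurable_funD => //; exact: emeasurable_funD.
  move=> y xy; have -> : h y = a y.
    rewrite /h indicE mem_set ?mul1e//=; apply/ballP.
    rewrite (le_lt_trans (metric_triangle x0 x y))// ltrD//; exact/ballP.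
  rewrite /osc /a/= -!EFinD -EFinM lee_fin.
  have := @powRD3_le _ p `|g x - f x| `|g y - g x| `|g y - f y| (ltW p0)
    (normr_ge0 _) (normr_ge0 _) (normr_ge0 _).
  apply: le_trans; apply: powR_le_compat; rewrite ?(ltW p0)//.
  rewrite (_ : f y - f x = (g x - f x) + (g y - g x) - (g y - f y)); last by ring.
  by rewrite (le_trans (ler_normB _ _))// lerD2r ler_normD.
have mfull : measurable_fun setT (fun x => a x +
    (invvol r x)%:E * \int[mu]_(y in ball x r) osc g (x, y)
    + (invvol r x)%:E * \int[mu]_(y in ball x r) h y)%E.
  apply: emeasurable_funD; last exact: emeasurable_funM.
  apply: emeasurable_funD => //; apply: emeasurable_funM => //;
    exact: measurable_near_integral.
apply: (@le_trans _ _ (\int[mu]_(x in ball x0 rho) ((3 `^ p)%:E * (a x +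
    (invvol r x)%:E * \int[mu]_(y in ball x r) osc g (x, y)
    + (invvol r x)%:E * \int[mu]_(y in ball x r) h y)))%E).
  apply: ge0_le_integral => //.
  - by move=> x _; rewrite mule_ge0// integral_ge0.
  - apply: measurable_funTS; apply: emeasurable_funM => //;
      exact: measurable_near_integral.
  - by apply: measurable_funTS; exact: emeasurable_funM.
rewrite ge0_integralZl//; last 2 first.
- exact: measurable_funTS.
- by move=> x _; rewrite !adde_ge0// mule_ge0.
apply: lee_wpmul2l => //.
have mo : measurable_fun setT (fun x =>
    (invvol r x)%:E * \int[mu]_(y in ball x r) osc g (x, y))%E.
  apply: emeasurable_funM => //;
    exact: measurable_near_integral.
have mi : measurable_fun setT (fun x =>
    (invvol r x)%:E * \int[mu]_(y in ball x r) h y)%E.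
  exact: emeasurable_funM.
rewrite ge0_integralD//; last 4 first.
- by move=> x _; rewrite adde_ge0// mule_ge0.
- by apply: measurable_funTS; exact: emeasurable_funD.
- by move=> x _; rewrite mule_ge0.
- exact: measurable_funTS.
rewrite ge0_integralD//; last 3 first.
- exact: measurable_funTS.
- by move=> x _; rewrite mule_ge0.
- exact: measurable_funTS.
have a00 : (0 <= \int[mu]_(y in D') a y)%E by exact: integral_ge0.
rewrite EFinD ge0_muleDl ?lee_fin// ?(ltW C0)// mul1e addeAC leeD//; last first.
  apply: ge0_subset_integral => //.
  by move=> x _; rewrite mule_ge0.
apply: leeD.
  apply: ge0_subset_integral => //; first exact: measurable_funTS.
  by apply: subset_ball; rewrite mdistxx add0r lerDl ltW.
apply: (@le_trans _ _ (\int[mu]_x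
    ((invvol r x)%:E * \int[mu]_(y in ball x r) h y))%E).
  apply: ge0_subset_integral => //.
  by move=> x _; rewrite mule_ge0.
have -> : (\int[mu]_(y in D') a y = \int[mu]_y h y)%E.
  by rewrite integral_mkcond epatch_indic; apply: eq_integral => y _ /=; exact: muleC.
apply: integral_avg_le => // y z yz.
rewrite -(expr1 C); apply: (vol_comparable open_measurable CP) => //.
by rewrite expr1 metric_sym; lra.
Qed.

(** The bound by the Lipschitz energies is transferred to [f] on each ball, and
the balls exhaust the space. *)
Lemma near_avg_le_liminf (x0 : X) : poincare mu p -> exists2 K, 0 < K &
  forall f (f_ : nat -> X -> R) r, measurable_fun setT f ->
    (forall n, locally_lipschitz (f_ n)) -> cvg_Lploc mu p f_ f -> 0 < r ->
  (near_avg r (osc f) <= (K * r `^ p)%:E *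
     limn_einf (fun n => \int[mu]_y (Lip (f_ n) y `^ p)))%E.
Proof.
move=> /near_avg_le_Lip[K K0 hK].
have c3 : 0 < (3 : R) `^ p by exact: powR_gt0.
exists (3 `^ p * K); first exact: mulr_gt0.
move=> f f_ r mf lf cf r0.
set L := limn_einf _.
have rp0 : 0 < r `^ p by exact: powR_gt0.
pose H x := ((invvol r x)%:E * \int[mu]_(y in ball x r) osc f (x, y))%E.
have H0 x : (0 <= H x)%E by rewrite mule_ge0// integral_ge0.
have mH : measurable_fun setT H by apply: emeasurable_funM => //;
  exact: measurable_near_integral.
have L0 : (0 <= L)%E.
  rewrite [L](_ : _ = limf_einf
    (fun n => \int[mu]_y (Lip (f_ n) y `^ p))%E \oo)// limf_einfE.
  apply: le_ereal_sup_tmp; eexists; first by exists setT => //; exact: filterT.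
  apply: le_ereal_inf_tmp => _ [n _ <-].
  by apply: integral_ge0 => y _; exact: poweR_ge0.
suff Hball rho : 0 < rho ->
    (\int[mu]_(x in ball x0 rho) H x <= (3 `^ p * K * r `^ p)%:E * L)%E.
  have TE : setT = \bigcup_n ball x0 n.+1%:R.
    apply/esym; rewrite -subTset => x _; exists (Num.truncn (mdist x0 x)) => //.
    exact/ballP/truncnS_gt.
  have hc : (\int[mu]_(x in ball x0 n.+1%:R) H x @[n --> \oo] -->
      \int[mu]_x H x)%E.
    rewrite [in X in _ --> X]TE; apply: ge0_nondecreasing_set_cvg_integral => //.
    - apply/nondecreasing_seqP => n; apply/subsetPset.
      by apply: subset_ball; rewrite mdistxx add0r ler_nat.
    - by move=> n; exact: measurable_funTS.
  rewrite /near_avg -(cvg_lim _ hc)//; apply: lime_le.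
    by apply/cvg_ex; eexists; exact: hc.
  by apply: nearW => n; exact: Hball.
move=> rho0.
case LE : L L0 => [l| |//] L0; last first.
  by rewrite gt0_muley ?leey// lte_fin !mulr_gt0.
apply/lee_addgt0Pr => e e0.
(* [e'] bounds both the distance to [f] and the excess of the Lipschitz energy
   over [l]; the sum of their contributions is then [e] *)
pose e' := e / (3 `^ p * ((1 + C) + K * r `^ p)).
have den0 : 0 < 3 `^ p * ((1 + C) + K * r `^ p).
  by rewrite mulr_gt0// !addr_gt0// mulr_gt0.
have e'0 : 0 < e' by exact: divr_gt0.
have rr0 : 0 < rho + r by rewrite addr_gt0.
pose err n := (\int[mu]_(y in ball x0 (rho + r)) (`|f_ n y - f y| `^ p)%:E)%E.
have Ae : \forall n \near \oo, (err n < e'%:E)%E.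
  have /(_ [set u | (u < e'%:E)%E]) := cf x0 _ rr0; apply.
  apply: open_nbhs_nbhs; split; first exact: open_ereal_lt_ereal.
  by rewrite /= lte_fin.
have [n /= hn hL] : exists2 n,
    (err n < e'%:E)%E & (\int[mu]_y (Lip (f_ n) y `^ p) < (l + e')%:E)%E.
  apply: limf_einf_lt Ae; rewrite (_ : limf_einf _ _ = l%:E); last exact: LE.
  by rewrite lte_fin ltrDl.
have mfn : measurable_fun setT (f_ n).
  exact/(continuous_measurable open_measurable)/locally_lipschitz_continuous.
apply: (le_trans (near_avg_ball_perturb x0 mf mfn rho0 r0)).
apply: (@le_trans _ _ ((3 `^ p)%:E *
    ((1 + C)%:E * e'%:E + (K * r `^ p)%:E * (l + e')%:E)))%E.
  apply: lee_wpmul2l; first by rewrite lee_fin ltW.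
  apply: leeD.
    apply: lee_wpmul2l; last exact: ltW.
    by rewrite lee_fin addr_ge0// ltW.
  apply: (le_trans (hK _ _ (lf n) r0)); apply: lee_wpmul2l; last exact: ltW.
  by rewrite lee_fin mulr_ge0// ltW.
rewrite -!EFinM -!EFinD lee_fin le_eqVlt; apply/orP; left; apply/eqP.
rewrite /e'; field; rewrite !gt_eqF//.
by rewrite addr_gt0// ?addr_gt0// mulr_gt0.
Qed.

Lemma E_le_relaxed_energy (x0 : X) : poincare mu p -> exists2 K, 0 < K &
  forall f r, measurable_fun setT f -> 0 < r ->
  (E mu p 1 f r <= K%:E * relaxed_energy mu p f)%E.
Proof.
move=> /(near_avg_le_liminf x0)[K K0 hK]; exists K => // f r mf r0.
rewrite -lee_pdivrMl//; apply: le_ereal_inf_tmp => _ [f_ [lf cf] <-].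
rewrite lee_pdivrMl// E_near_avg// mulr1.
have rp0 : 0 < r `^ p by exact: powR_gt0.
by rewrite lee_pdivrMl// muleA -EFinM mulrC; exact: hK.
Qed.

(** * Approximation by locally Lipschitz functions *)

Definition tent r x z : R := Num.max 0 (r - mdist x z).

Lemma tent_ge0 r x z : 0 <= tent r x z.
Proof. by rewrite le_max lexx. Qed.

Lemma tent_le r x z : 0 < r -> `|tent r x z| <= r * \1_(ball x r) z.
Proof.
move=> r0; rewrite ger0_norm ?tent_ge0// indic_ball /tent ge_max.
have := mdist_ge0 x z; have [xz|xz] := ltP => d0; rewrite ?mulr1 ?mulr0 ?lexx/=; lra.
Qed.

Lemma tent_lipschitz r x y z : `|tent r x z - tent r y z| <= mdist x y.
Proof.
rewrite /tent; have := metric_triangle x y z; have := metric_triangle y x z.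
rewrite (metric_sym y x) ler_norml.
by have [] := leP 0 (r - mdist x z); have [] := leP 0 (r - mdist y z);
  have := mdist_ge0 x y; lra.
Qed.

Lemma tentC r x z : tent r x z = tent r z x.
Proof. by rewrite /tent metric_sym. Qed.

Lemma measurable_tent r x : measurable_fun setT (tent r x).
Proof.
apply: (continuous_measurable open_measurable).
apply: locally_lipschitz_continuous => y; exists 1, 1; split => // u v _ _.
by rewrite mul1r !(tentC r x) tent_lipschitz.
Qed.

Section smoothing.
Variable f : X -> R.
Hypothesis mf : measurable_fun setT f.
Hypothesis f_locint : forall x r, 0 < r ->
  (\int[mu]_(y in ball x r) `|f y|%:E < +oo)%E.

Let mfc c : measurable_fun setT (fun y => f y - c).
Proof. exact: measurable_funB. Qed.

Let locint c x r : 0 < r -> (\int[mu]_(y in ball x r) `|f y - c|%:E < +oo)%E.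
Proof.
move=> r0; apply: (@le_lt_trans _ _
    (\int[mu]_(y in ball x r) (`|f y|%:E + `|c|%:E))%E).
  apply: ge0_le_integral => //.
  - by apply/measurable_EFinP/measurable_funTS; exact: measurableT_comp.
  - apply/measurable_EFinP/measurable_funTS.
    by apply: measurable_funD => //; exact: measurableT_comp.
  - by move=> y _; rewrite -EFinD lee_fin ler_normB.
rewrite ge0_integralD//; last first.
  by apply/measurable_EFinP/measurable_funTS; exact: measurableT_comp.
by rewrite integral_cst// (mu_ball CP)// lte_add_pinfty ?f_locint// -EFinM ltry.
Qed.

Definition local_L1 c x r : R := fine (\int[mu]_(y in ball x r) `|f y - c|%:E)%E.

Lemma local_L1E c x r : 0 < r ->
  (local_L1 c x r)%:E = (\int[mu]_(y in ball x r) `|f y - c|%:E)%E.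
Proof.
by move=> r0; rewrite /local_L1 fineK// ge0_fin_numE ?locint// integral_ge0.
Qed.

Section weight.
Variables (k : X -> R) (x : X) (r M : R).
Hypotheses (mk : measurable_fun setT k) (r0 : 0 < r) (M0 : 0 <= M).
Hypothesis kM : forall z, `|k z| <= M * \1_(ball x r) z.

Lemma integral_weight_le c :
  (\int[mu]_z `|(k z * (f z - c))%:E| <= (M * local_L1 c x r)%:E)%E.
Proof.
rewrite EFinM local_L1E// integral_ballE -ge0_integralZl//; last first.
  apply: emeasurable_funM; apply/measurable_EFinP.
    exact: measurable_indic.
  exact: measurableT_comp.
apply: ge0_le_integral => //.
- by apply/measurable_EFinP; apply: measurableT_comp => //; exact: measurable_funM.
- apply: emeasurable_funM => //; apply: emeasurable_funM; apply/measurable_EFinP.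
    exact: measurable_indic.
  exact: measurableT_comp.
by move=> z _; rewrite muleA -!EFinM lee_fin normrM ler_wpM2r.
Qed.

Lemma integrable_weight c : mu.-integrable setT (EFin \o (fun z => k z * (f z - c))).
Proof.
apply/integrableP; split; first by apply/measurable_EFinP; exact: measurable_funM.
exact: le_lt_trans (integral_weight_le c) (ltry _).
Qed.

Lemma Rintegral_weight_le c :
  `|\int[mu]_z (k z * (f z - c))| <= M * local_L1 c x r.
Proof.
apply: le_trans (le_normr_Rintegral _ (integrable_weight c)) _ => //.
rewrite -lee_fin /Rintegral fineK.
  exact: integral_weight_le.
rewrite ge0_fin_numE ?integral_ge0//.
exact: le_lt_trans (integral_weight_le c) (ltry _).
Qed.

End weight.

Definition tent_mass r x : R := \int[mu]_z tent r x z.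

(** The average of [f] near [x], with weights that are Lipschitz in [x]. *)
Definition smooth r x : R := (tent_mass r x)^-1 * \int[mu]_z (tent r x z * f z).

Section fixed_radius.
Variable r : R.
Hypothesis r0 : 0 < r.

Let mb x : measurable_fun setT (tent r x). Proof. exact: measurable_tent. Qed.

Lemma integrable_tent x : mu.-integrable setT (EFin \o tent r x).
Proof.
apply/integrableP; split; first exact/measurable_EFinP.
apply: (@le_lt_trans _ _ (\int[mu]_z (r%:E * (\1_(ball x r) z)%:E))%E).
  apply: ge0_le_integral => //.
  - by apply/measurable_EFinP; exact: measurableT_comp.
  - by apply: emeasurable_funM => //; exact/measurable_EFinP/measurable_indic.
  - by move=> z _; rewrite -EFinM lee_fin; exact: tent_le.
rewrite ge0_integralZl//; last 2 first.
- exact/measurable_EFinP/measurable_indic.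
- by rewrite lee_fin ltW.
by rewrite integral_indic_ball// -EFinM ltry.
Qed.

Lemma tent_mass_ge x : r * vol x r <= 2 * C * tent_mass r x.
Proof.
have r20 : 0 < r / 2 by rewrite divr_gt0.
have h : r / 2 * vol x (r / 2) <= tent_mass r x.
  rewrite -lee_fin /tent_mass /Rintegral fineK; last first.
    exact: integrable_fin_num (integrable_tent x).
  rewrite EFinM -integral_indic_ball// -ge0_integralZl//; last 2 first.
  - exact/measurable_EFinP/measurable_indic.
  - by rewrite lee_fin ltW.
  apply: ge0_le_integral => //.
  - by move=> z _; rewrite -EFinM lee_fin mulr_ge0// ltW.
  - by apply: emeasurable_funM => //; exact/measurable_EFinP/measurable_indic.
  - exact/measurable_EFinP.
  move=> z _; rewrite -EFinM lee_fin indic_ball.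
  have [xz|_] := ltP; last by rewrite mulr0 tent_ge0.
  by rewrite mulr1 /tent le_max; apply/orP; right; lra.
have v2 : vol x r <= C * vol x (r / 2).
  rewrite -(expr1 C); apply: (vol_comparable open_measurable CP) => //.
  by rewrite mdistxx expr1; lra.
apply: (@le_trans _ _ (r * (C * vol x (r / 2)))); first exact: (ler_wpM2l (ltW r0) v2).
by have := ler_wpM2l (ltW C0) h; lra.
Qed.

Lemma tent_mass_gt0 x : 0 < tent_mass r x.
Proof.
have := tent_mass_ge x; rewrite -ler_pdivrMl ?mulr_gt0//; apply: lt_le_trans.
by rewrite !mulr_gt0 ?invr_gt0 ?mulr_gt0// (vol_gt0 CP).
Qed.

(** Subtracting a constant [c] commutes with averaging; [c] is chosen below so as
to make one of these integrals vanish. *)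
Lemma tent_mass_smooth x c :
  tent_mass r x * (smooth r x - c) = \int[mu]_z (tent r x z * (f z - c)).
Proof.
have i0 : mu.-integrable setT (EFin \o (fun z => tent r x z * f z)).
  have := @integrable_weight (tent r x) x r r (mb x) r0 (ltW r0)
    (fun z => tent_le x z r0) 0.
  by under eq_fun do rewrite /= subr0.
have i1 : mu.-integrable setT (EFin \o (fun z => tent r x z * c)).
  have -> : EFin \o (fun z => tent r x z * c) =
      (fun z => c%:E * (EFin \o tent r x) z)%E.
    by apply/funext => z /=; rewrite -EFinM mulrC.
  by apply: integrableZl => //; exact: integrable_tent.
under [RHS]eq_Rintegral do rewrite mulrBr.
rewrite RintegralB// RintegralZr//; last exact: integrable_tent.
rewrite mulrBr /smooth mulrA mulfV ?mul1r// gt_eqF//; exact: tent_mass_gt0.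
Qed.

Lemma smooth_dist_le x c :
  `|smooth r x - c| * vol x r <= 2 * C * local_L1 c x r.
Proof.
rewrite -(ler_pM2l r0).
have h := @Rintegral_weight_le (tent r x) x r r (mb x) r0 (ltW r0)
    (fun z => tent_le x z r0) c.
move: h; rewrite -tent_mass_smooth normrM (gtr0_norm (tent_mass_gt0 x)) => h.
have := ler_wpM2l (normr_ge0 (smooth r x - c)) (tent_mass_ge x).
have := ler_wpM2l (ltW (mulr_gt0 (ltr0n R 2) C0)) h.
set a := `|_|; lra.
Qed.

(** For [c := smooth r y] the integral of [tent r y z * (f z - c)] over [z] is
zero. The difference of the averages at [x] and [y] is therefore the integral of
[f - c] against the difference of the two tents, divided by the mass of one. *)
Lemma smooth_lipschitz_at x y : mdist x y < r ->
  `|smooth r x - smooth r y| <=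
    2 * C ^+ 3 / (r * vol y (2 * r)) * local_L1 (smooth r y) y (2 * r) * mdist x y.
Proof.
move=> xy; have r20 : 0 < 2 * r by exact: mulr_gt0.
pose c := smooth r y.
have ib u : mu.-integrable setT (EFin \o (fun z => tent r u z * (f z - c))).
  exact: (@integrable_weight (tent r u) u r r (mb u) r0 (ltW r0)
    (fun z => tent_le u z r0) c).
have e : tent_mass r x * (smooth r x - c) =
    \int[mu]_z ((tent r x z - tent r y z) * (f z - c)).
  under [RHS]eq_Rintegral do rewrite mulrBl.
  by rewrite RintegralB// -!tent_mass_smooth subrr mulr0 subr0.
have kle z : `|tent r x z - tent r y z| <= mdist x y * \1_(ball y (2 * r)) z.
  rewrite indic_ball; have [yz|yz] := ltP.
    by rewrite mulr1 tent_lipschitz.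
  have xz : r <= mdist x z.
    by have := metric_triangle y x z; rewrite (metric_sym y x); lra.
  rewrite mulr0 /tent !max_l ?subrr ?normr0//; lra.
have := @Rintegral_weight_le _ y (2 * r) (mdist x y)
  (measurable_funB (mb x) (mb y)) r20 (mdist_ge0 _ _) kle c.
rewrite /= -e normrM (gtr0_norm (tent_mass_gt0 x)) => h.
have vy := vol_gt0 CP y r20.
have vyx : vol y (2 * r) <= C ^+ 2 * vol x r.
  by apply: (vol_comparable open_measurable CP) => //; lra.
have m1 : r * vol y (2 * r) <= 2 * C ^+ 3 * tent_mass r x.
  have := ler_wpM2l (ltW r0) vyx.
  have := ler_wpM2l (ltW (exprn_gt0 2 C0)) (tent_mass_ge x).
  rewrite (exprS C 2); lra.
have rv : 0 < r * vol y (2 * r) by exact: mulr_gt0.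
rewrite mulrAC -mulrA mulrAC ler_pdivlMr//.
have := ler_wpM2l (normr_ge0 (smooth r x - c)) m1.
have c3 : 0 <= 2 * C ^+ 3 by rewrite mulr_ge0// exprn_ge0// ltW.
have := ler_wpM2l c3 h; rewrite /c; set a := `|_|; lra.
Qed.

(** Near [x0] the balls in the previous bound have comparable measure and lie in
a single ball, so the local constants are uniformly bounded. *)
Lemma locally_lipschitz_smooth : locally_lipschitz (smooth r).
Proof.
move=> x0; have r20 : 0 < r / 2 by rewrite divr_gt0.
have r2 : 0 < 2 * r by exact: mulr_gt0.
have r3 : 0 < 3 * r by exact: mulr_gt0.
pose F := local_L1 0 x0 (3 * r); pose v := vol x0 (r / 2).
have v0 : 0 < v by exact: (vol_gt0 CP).
have mono u s : 0 < s -> mdist x0 u + s <= 3 * r -> local_L1 0 u s <= F.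
  move=> s0 us; rewrite -lee_fin !local_L1E//; apply: ge0_subset_integral => //.
    apply/measurable_EFinP/measurable_funTS; apply: measurableT_comp => //; exact: mfc.
  exact: subset_ball.
have F0 : 0 <= F by rewrite fine_ge0// integral_ge0.
exists (r / 2), (2 * C ^+ 3 / r * ((1 + 2 * C) * F / v)); split => //.
move=> y z /ballP xy /ballP xz.
have yz : mdist y z < r.
  by have := metric_triangle y x0 z; rewrite (metric_sym y x0); lra.
apply: (le_trans (smooth_lipschitz_at yz)); rewrite ler_wpM2r ?mdist_ge0//.
have vz := vol_gt0 CP z r0; have vz2 := vol_gt0 CP z r2.
have vzz : v <= vol z r.
  by apply: (vol_subset open_measurable CP) => //; rewrite metric_sym; lra.
have vz12 : vol z r <= vol z (2 * r).
  by apply: (vol_subset open_measurable CP) => //; rewrite mdistxx; lra.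
have h1 : `|smooth r z| * vol z r <= 2 * C * F.
  have := smooth_dist_le z 0; rewrite subr0 => /le_trans; apply.
  have C2 : 0 <= 2 * C by rewrite mulr_ge0// ltW.
  by apply: (ler_wpM2l C2); apply: mono => //; lra.
have h2 : local_L1 (smooth r z) z (2 * r) <= F + `|smooth r z| * vol z (2 * r).
  apply: (@le_trans _ _ (local_L1 0 z (2 * r) + `|smooth r z| * vol z (2 * r))).
    have mab e : measurable_fun (ball z (2 * r)) (fun u => `|f u - e|%:E).
      apply/measurable_EFinP/measurable_funTS.
      by apply: measurableT_comp => //; exact: mfc.
    have s0 u : (0 <= cst `|smooth r z|%:E u)%E by rewrite /= lee_fin.
    rewrite -lee_fin EFinD EFinM !local_L1E// -(mu_ball CP)// -integral_cst//.
    rewrite -ge0_integralD//; apply: ge0_le_integral => //.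
      by apply: emeasurable_funD => //; exact: mab.
    by move=> u _; rewrite /= -EFinD lee_fin subr0 ler_normB.
  by rewrite lerD2r; apply: mono => //; lra.
have h3 : F <= F / v * vol z (2 * r).
  rewrite -mulrAC ler_pdivlMr// ler_wpM2l//; exact: le_trans vz12.
have h4 : `|smooth r z| <= 2 * C * F / v.
  rewrite ler_pdivlMr//; apply: le_trans h1; rewrite ler_wpM2l//.
have h5 : local_L1 (smooth r z) z (2 * r) <= (1 + 2 * C) * F / v * vol z (2 * r).
  apply: (le_trans h2); have := ler_wpM2r (ltW vz2) h4; lra.
have c3 : 0 <= 2 * C ^+ 3 by rewrite mulr_ge0// exprn_ge0// ltW.
rewrite [leLHS](_ : _ = 2 * C ^+ 3 / r *
    (local_L1 (smooth r z) z (2 * r) / vol z (2 * r))).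
  apply: ler_wpM2l; first by rewrite divr_ge0// ltW.
  by rewrite ler_pdivrMr.
by field; rewrite !gt_eqF.
Qed.

(** The power mean inequality applied to [smooth_dist_le]. *)
Lemma smooth_powR_dist x c :
  ((`|smooth r x - c| `^ p)%:E <=
   ((4 * C) `^ p / vol x r)%:E * \int[mu]_(y in ball x r) (`|f y - c| `^ p)%:E)%E.
Proof.
have v0 := vol_gt0 CP x r0.
have C2 : 0 < 2 * C by exact: mulr_gt0.
pose a := `|smooth r x - c| / (2 * C).
have a0 : 0 <= a by rewrite divr_ge0// ltW.
have J0 : (0 <= \int[mu]_(y in ball x r) (`|f y - c| `^ p)%:E)%E.
  exact: integral_ge0.
have h : ((a `^ p)%:E <= (2 `^ p / vol x r)%:E *
    \int[mu]_(y in ball x r) (`|f y - c| `^ p)%:E)%E.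
  apply: powR_average_le => //.
  - exact: (mu_ball CP).
  - by apply: measurable_funTS; apply: measurableT_comp => //; exact: mfc.
  rewrite -local_L1E// lee_fin /a mulrAC ler_pdivrMr// [leRHS]mulrC.
  exact: smooth_dist_le.
have -> : `|smooth r x - c| `^ p = (2 * C) `^ p * a `^ p.
  by rewrite -powRM ?(ltW C2)// /a (mulrC (2 * C)) divfK// gt_eqF.
rewrite EFinM; apply: (@le_trans _ _ (((2 * C) `^ p)%:E * ((2 `^ p / vol x r)%:E *
   \int[mu]_(y in ball x r) (`|f y - c| `^ p)%:E)))%E.
  by apply: lee_wpmul2l; rewrite // lee_fin powR_ge0.
rewrite muleA -EFinM mulrA -powRM ?(ltW C2)//.
by rewrite (_ : 2 * C * 2 = 4 * C)//; ring.
Qed.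

(** The Lipschitz constant at [x] is bounded by the mean distance of [f] to
[smooth r x], and that value is itself an average of [f]; taking powers inside
both averages leaves a double average of [osc f]. *)
Lemma Lip_smooth_le x :
  ((r `^ p)%:E * Lip (smooth r) x `^ p <=
   ((2 * C ^+ 3) `^ p * 2 `^ p * (4 * C) `^ p * C)%:E *
     ((invvol (2 * r) x ^+ 2)%:E *
      \int[mu]_(z in ball x (2 * r)) \int[mu]_(u in ball x (2 * r)) osc f (z, u)))%E.
Proof.
have r20 : 0 < 2 * r by exact: mulr_gt0.
have v0 := vol_gt0 CP x r0; have v20 := vol_gt0 CP x r20.
pose c := smooth r x.
pose a := local_L1 c x (2 * r) / vol x (2 * r).
have a0 : 0 <= a.
  by apply: divr_ge0; [apply: fine_ge0; exact: integral_ge0|exact: ltW].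
have c30 : 0 < 2 * C ^+ 3 by rewrite mulr_gt0// exprn_gt0.
have M0 : 0 <= 2 * C ^+ 3 / r * a.
  by apply: mulr_ge0 => //; apply: divr_ge0; exact: ltW.
have LM : (Lip (smooth r) x <= (2 * C ^+ 3 / r * a)%:E)%E.
  apply: (Lip_le r0 M0) => y yx; apply: (le_trans (smooth_lipschitz_at yx)).
  rewrite (_ : _ / _ * _ = 2 * C ^+ 3 / r * a)//.
  by rewrite /a; field; rewrite !gt_eqF.
have rp0 : 0 < r `^ p by exact: powR_gt0.
apply: (@le_trans _ _ ((2 * C ^+ 3) `^ p * a `^ p)%:E).
  apply: (@le_trans _ _ ((r `^ p)%:E * ((2 * C ^+ 3 / r * a)%:E `^ p)))%E.
    apply: lee_wpmul2l; first by rewrite lee_fin ltW.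
    by apply: poweR_le_compat => //; [exact: ltW|exact: Lip_ge0].
  rewrite poweR_EFin -EFinM -!powRM// ?(ltW c30) ?(ltW r0)//.
  by rewrite (_ : r * _ = 2 * C ^+ 3 * a)//; field; rewrite gt_eqF.
have h : ((a `^ p)%:E <= (2 `^ p / vol x (2 * r))%:E *
    \int[mu]_(y in ball x (2 * r)) (`|f y - c| `^ p)%:E)%E.
  apply: powR_average_le => //.
  - exact: (mu_ball CP).
  - by apply: measurable_funTS; apply: measurableT_comp => //; exact: mfc.
  by rewrite -local_L1E// lee_fin /a divfK// gt_eqF.
rewrite EFinM -!mulrA EFinM -muleA; apply: lee_wpmul2l.
  by rewrite lee_fin powR_ge0.
apply: (le_trans h).
have mo : measurable_fun setT
    (fun z => \int[mu]_(u in ball x (2 * r)) osc f (z, u))%E.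
  apply: (@measurable_integral_ball _ _ (cst x)) => //.
  exact: measurable_osc.
have o0 z : (0 <= \int[mu]_(u in ball x (2 * r)) osc f (z, u))%E by exact: integral_ge0.
have k0 : 0 < (4 * C) `^ p * C / vol x (2 * r).
  by rewrite divr_gt0// mulr_gt0// powR_gt0// mulr_gt0.
apply: (@le_trans _ _ ((2 `^ p / vol x (2 * r))%:E *
    (((4 * C) `^ p * C / vol x (2 * r))%:E *
    \int[mu]_(z in ball x (2 * r)) \int[mu]_(u in ball x (2 * r)) osc f (z, u)))%E).
  apply: lee_wpmul2l.
    by rewrite lee_fin; apply: divr_ge0; [exact: powR_ge0|exact: ltW].
  rewrite -ge0_integralZl//; last 2 first.
  - exact: measurable_funTS.
  - by rewrite lee_fin ltW.
  apply: ge0_le_integral => //.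
  - by apply: measurable_funTS; apply: mabs; exact: mfc.
  - by apply: measurable_funTS; apply: emeasurable_funM.
  move=> z _; rewrite distrC; apply: (le_trans (smooth_powR_dist x (f z))).
  have mof : measurable_fun setT (fun u => osc f (z, u)).
    exact: (measurableT_comp (measurable_osc mf) (measurable_fun_pair _ _)).
  have h1 : (4 * C) `^ p / vol x r <= (4 * C) `^ p * C / vol x (2 * r).
    rewrite -!mulrA ler_wpM2l ?powR_ge0// ler_pdivlMr// mulrC ler_pdivrMr//.
    by rewrite -(expr1 C); apply: (vol_comparable open_measurable CP) => //;
      rewrite mdistxx expr1 add0r.
  apply: lee_pmul => //.
  - by rewrite lee_fin; apply: divr_ge0; [exact: powR_ge0|exact: ltW].
  - exact: integral_ge0.
  apply: ge0_subset_integral => //; first exact: measurable_funTS.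
  by apply: subset_ball; rewrite mdistxx; lra.
rewrite !muleA -!EFinM le_eqVlt; apply/orP; left; apply/eqP.
by congr (_%:E * _)%E; rewrite /invvol; field; rewrite gt_eqF.
Qed.

Lemma integral_Lip_smooth_le :
  ((r `^ p)%:E * \int[mu]_x (Lip (smooth r) x `^ p) <=
   ((2 * C ^+ 3) `^ p * 2 `^ p * (4 * C) `^ p * C * C ^+ 4)%:E *
     near_avg (2 * (2 * r)) (osc f))%E.
Proof.
have r20 : 0 < 2 * r by exact: mulr_gt0.
have mL : measurable_fun setT (fun y => Lip (smooth r) y `^ p)%E.
  apply: (measurableT_comp (measurable_poweR p)); apply: measurable_Lip => //.
  exact/locally_lipschitz_continuous/locally_lipschitz_smooth.
have k0 : 0 <= (2 * C ^+ 3) `^ p * 2 `^ p * (4 * C) `^ p * C.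
  by do !apply: mulr_ge0 => //; rewrite ?powR_ge0// ltW.
have mB := measurable_ball_integral (2 * r) mf.
rewrite -ge0_integralZl//; last 2 first.
- by move=> x _; exact: poweR_ge0.
- by rewrite lee_fin powR_ge0.
apply: (@le_trans _ _ (((2 * C ^+ 3) `^ p * 2 `^ p * (4 * C) `^ p * C)%:E *
    ball_avg (2 * r) (osc f)))%E.
  rewrite -ge0_integralZl//; last first.
    move=> z _; rewrite mule_ge0 ?lee_fin ?sqr_ge0// integral_ge0// => x _.
    exact: integral_ge0.
  apply: ge0_le_integral => //.
  - by move=> x _; rewrite mule_ge0 ?lee_fin ?powR_ge0 ?poweR_ge0.
  - exact: emeasurable_funM.
  - exact: emeasurable_funM.
  - by move=> x _; exact: Lip_smooth_le.
rewrite [X in (_ <= X * _)%E]EFinM -muleA; apply: lee_wpmul2l => //.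
apply: ball_avg_le => //; exact: measurable_osc.
Qed.

Lemma integral_smooth_dist_le :
  (\int[mu]_x (`|smooth r x - f x| `^ p)%:E <=
   ((4 * C) `^ p)%:E * near_avg r (osc f))%E.
Proof.
have ms : measurable_fun setT (smooth r).
  apply: (continuous_measurable open_measurable).
  exact/locally_lipschitz_continuous/locally_lipschitz_smooth.
have mn : measurable_fun setT (fun x =>
    (invvol r x)%:E * \int[mu]_(y in ball x r) osc f (x, y))%E.
  by apply: emeasurable_funM => //;
    exact: measurable_near_integral.
rewrite -ge0_integralZl//; last 2 first.
- by move=> x _; rewrite mule_ge0// integral_ge0.
- by rewrite lee_fin powR_ge0.
apply: ge0_le_integral => //.
- by apply: mabs; exact: measurable_funB.
- exact: emeasurable_funM.
by move=> x _; rewrite muleA -EFinM; exact: smooth_powR_dist.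
Qed.

End fixed_radius.
End smoothing.

Lemma near_avg_radius f r : measurable_fun setT f -> 0 < r ->
  (near_avg r (osc f) <= (C ^+ 2)%:E * near_avg (2 * (2 * r)) (osc f))%E.
Proof.
move=> mf r0; have r40 : 0 < 2 * (2 * r) by rewrite !mulr_gt0.
have mn s : measurable_fun setT (fun x =>
    (invvol s x)%:E * \int[mu]_(y in ball x s) osc f (x, y))%E.
  by apply: emeasurable_funM => //;
    exact: measurable_near_integral.
have n0 s x : (0 <= (invvol s x)%:E * \int[mu]_(y in ball x s) osc f (x, y))%E.
  by rewrite mule_ge0// integral_ge0.
rewrite -ge0_integralZl//; last by rewrite lee_fin exprn_ge0// ltW.
apply: ge0_le_integral => //; first exact: emeasurable_funM.
move=> x _; rewrite muleA -EFinM; apply: lee_pmul => //.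
- exact: integral_ge0.
- have v0 := vol_gt0 CP x r0; have v40 := vol_gt0 CP x r40.
  rewrite lee_fin /invvol ler_pdivlMr// mulrC ler_pdivrMr//.
  by apply: (vol_comparable open_measurable CP) => //; rewrite mdistxx; lra.
apply: ge0_subset_integral => //.
- apply: measurable_funTS.
  exact: (measurableT_comp (measurable_osc mf) (measurable_fun_pair _ _)).
- by apply: subset_ball; rewrite mdistxx; lra.
Qed.

(** * The critical exponent and the variation *)

Lemma LfunE f : (f \in Lfun mu p%:E) <->
  (measurable_fun setT f /\ (\int[mu]_x (`|f x| `^ p)%:E < +oo)%E).
Proof.
have pn0 : p != 0 by rewrite gt_eqF.
have e : ('N[mu]_p%:E[EFin \o f] `^ p = \int[mu]_x (`|f x| `^ p)%:E)%E.
  by rewrite poweR_Lnorm.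
split=> [|[mf lf]]; rewrite inE/=.
  move=> /andP[/set_mem mf /set_mem/= nf]; split => //.
  by rewrite -e; exact: poweR_lty.
apply/andP; split; apply/mem_set => //=.
by apply: (@lty_poweRy _ _ p) => //; rewrite e.
Qed.

Lemma Lfun_locally_integrable f x r : f \in Lfun mu p%:E -> 0 < r ->
  (\int[mu]_(y in ball x r) `|f y|%:E < +oo)%E.
Proof.
move=> /LfunE[mf lf] r0.
apply: (@le_lt_trans _ _
    (\int[mu]_(y in ball x r) (cst 1 y + (`|f y| `^ p)%:E))%E).
  apply: ge0_le_integral => //.
  - by apply/measurable_EFinP/measurable_funTS; exact: measurableT_comp.
  - by apply: emeasurable_funD => //; apply: measurable_funTS; exact: mabs.
  - by move=> y _; rewrite /= -EFinD lee_fin le_1D_powR.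
rewrite ge0_integralD//; last by apply: measurable_funTS; exact: mabs.
rewrite integral_cst// (mu_ball CP)// mul1e lte_add_pinfty ?ltry//.
apply: le_lt_trans lf; apply: ge0_subset_integral => //; exact: mabs.
Qed.

Lemma E_ge0 alpha f r : (0 <= E mu p alpha f r)%E.
Proof.
apply: integral_ge0 => x _; rewrite mule_ge0 ?inve_ge0//.
by apply: integral_ge0 => y _; rewrite lee_fin divr_ge0// powR_ge0.
Qed.

(** The approximations are [smooth] at the radii [rho n / 4], where the energies
at [rho n] approach their lower limit. The factor 4 is the one lost in
[integral_Lip_smooth_le]. *)
Lemma relaxed_energy_le_liminf : exists2 K, 0 < K &
  forall f, f \in Lfun mu p%:E ->
  (relaxed_energy mu p f <= K%:E * limf_einf (E mu p 1 f) 0^'+)%E.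
Proof.
pose K1 : R := (2 * C ^+ 3) `^ p * 2 `^ p * (4 * C) `^ p * C * C ^+ 4.
have K10 : 0 < K1.
  by rewrite /K1; do !apply: mulr_gt0 => //; rewrite ?powR_gt0 ?mulr_gt0 ?exprn_gt0.
have four0 : 0 < (4 : R) `^ p by exact: powR_gt0.
exists (K1 * 4 `^ p); first exact: mulr_gt0.
move=> f fL; have [mf _] := (LfunE f).1 fL.
have loc x r : 0 < r -> _ := @Lfun_locally_integrable f x r fL.
set L := limf_einf _ _.
have L0 : (0 <= L)%E.
  by apply: limf_einf_ge0 => [|r]; [exact: filterT|exact: E_ge0].
have K0 : 0 < K1 * 4 `^ p by exact: mulr_gt0.
case LE : L L0 => [l| |//] L0; last by rewrite gt0_muley ?leey// lte_fin.
apply/lee_addgt0Pr => e e0.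
pose e' := e / (K1 * 4 `^ p); have e'0 : 0 < e' by exact: divr_gt0.
have /choice[rho hrho] (n : nat) : exists r : R,
    [/\ 0 < r, r < n.+1%:R^-1 & (E mu p 1 f r < (l + e')%:E)%E].
  have FA : (0 : R)^'+ [set r | 0 < r < n.+1%:R^-1].
    near=> r; apply/andP; split; near: r; [exact: nbhs_right_gt|exact: nbhs_right_lt].
  have LA : (limf_einf (E mu p 1 f) 0^'+ < (l + e')%:E)%E.
    by rewrite -/L LE lte_fin ltrDl.
  by have [r /= /andP[r0 rn] rE] := limf_einf_lt LA FA; exists r.
pose s n := rho n / 4.
have s0 n : 0 < s n by have [r0 _ _] := hrho n; exact: divr_gt0.
have s4 n : 2 * (2 * s n) = rho n by rewrite /s; field.
have near_rho n : (near_avg (2 * (2 * s n)) (osc f) =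
    ((rho n) `^ p)%:E * E mu p 1 f (rho n))%E.
  have [r0 _ _] := hrho n; rewrite s4 E_near_avg// mulr1 muleA.
  by rewrite -EFinM mulfV ?mul1e// gt_eqF// powR_gt0.
pose f_ n := smooth f (s n).
have lf n : locally_lipschitz (f_ n).
  exact: locally_lipschitz_smooth.
have cf : cvg_Lploc mu p f_ f.
  move=> x t t0.
  pose K2 := (4 * C) `^ p * (C ^+ 2 * (l + e')).
  have le0 : 0 <= l + e' by apply: addr_ge0; [rewrite -lee_fin|exact: ltW].
  have K20 : 0 <= K2.
    by apply: mulr_ge0; rewrite ?powR_ge0// mulr_ge0// exprn_ge0// ltW.
  have bound n : (\int[mu]_(y in ball x t) (`|f_ n y - f y| `^ p)%:E <=
      K2%:E * (n.+1%:R^-1)%:E)%E.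
    have [r0 rn rE] := hrho n.
    apply: (@le_trans _ _ (\int[mu]_y (`|f_ n y - f y| `^ p)%:E)%E).
      apply: ge0_subset_integral => //; apply: mabs; apply: measurable_funB => //.
      exact/(continuous_measurable open_measurable)/locally_lipschitz_continuous.
    apply: (le_trans (integral_smooth_dist_le mf loc (s0 n))).
    rewrite /K2 EFinM -muleA; apply: lee_wpmul2l; first by rewrite lee_fin powR_ge0.
    apply: (le_trans (near_avg_radius mf (s0 n))).
    rewrite (EFinM (C ^+ 2)) -muleA; apply: lee_wpmul2l.
      by rewrite lee_fin exprn_ge0// ltW.
    rewrite near_rho muleC; apply: lee_pmul => //; [exact: E_ge0| |exact: ltW|].
      by rewrite lee_fin powR_ge0.
    rewrite lee_fin; apply: le_trans (ltW rn); rewrite ge1r_powR// r0.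
    by rewrite (le_trans (ltW rn))// invf_le1 ?ler1n.
  apply: (@squeeze_cvge _ _ _ _ (cst 0%E) _ (fun n => (K2%:E * (n.+1%:R^-1)%:E)%E)).
  - by apply: nearW => n; rewrite bound andbT integral_ge0.
  - exact: cvg_cst.
  - rewrite -(mule0 K2%:E); apply: cvgeZl => //.
    by apply: cvg_EFin; [exact: nearW|exact: cvg_harmonic].
apply: (@le_trans _ _ (limn_einf (fun n => \int[mu]_y (Lip (f_ n) y `^ p)))%E).
  by apply: ereal_inf_lbound; exists f_.
apply: limn_einf_le => n; have [r0 rn rE] := hrho n.
have sp0 : 0 < s n `^ p by exact: powR_gt0.
have := integral_Lip_smooth_le mf loc (s0 n).
rewrite near_rho -/K1 -lee_pdivlMl// => /le_trans; apply.
have e4 : (s n `^ p)^-1 * (K1 * rho n `^ p) = K1 * 4 `^ p.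
  rewrite (_ : rho n = 4 * s n); last by rewrite /s; field.
  by rewrite powRM ?(ltW (s0 n))//; field; rewrite gt_eqF.
rewrite !muleA -!EFinM -mulrA e4.
apply: (@le_trans _ _ ((K1 * 4 `^ p)%:E * (l + e')%:E)%E).
  by apply: lee_wpmul2l; [rewrite lee_fin ltW|exact: ltW].
rewrite -EFinM -EFinD lee_fin mulrDr lerD2l /e' mulrC divfK// gt_eqF//.
Unshelve. all: by end_near. Qed.

Lemma ae_ball_exists (P : X -> Prop) x0 r : 0 < r -> {ae mu, forall x, P x} ->
  exists2 x, ball x0 r x & P x.
Proof.
move=> r0 [N [mN N0 PN]]; apply: contrapT => nP.
have BN : ball x0 r `<=` N by move=> x Bx; apply: PN => /= Px; apply: nP; exists x.
have : (mu (ball x0 r) <= mu N)%E by apply: le_measure; rewrite ?inE.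
by rewrite (mu_ball CP)// N0 lee_fin leNgt (vol_gt0 CP).
Qed.

(** For almost every [x], the integral of [`|f y - f x| `^ p] over [y] vanishes on
all balls about [x]; the value at one such [x] is the constant. *)
Lemma near_avg_eq0_ae_constant (x0 : X) f : measurable_fun setT f ->
  (forall r, 0 < r -> near_avg r (osc f) = 0%E) -> ae_constant mu f.
Proof.
move=> mf n0.
have mx x : measurable_fun setT (fun y => osc f (x, y)).
  exact: (measurableT_comp (measurable_osc mf) (measurable_fun_pair _ _)).
have : {ae mu, forall x, forall n : nat,
    setT x -> ((invvol n.+1%:R x)%:E *
      \int[mu]_(y in ball x n.+1%:R) osc f (x, y) = 0)%E}.
  apply: ae_foralln => n; apply: ge0_integral_eq0_ae => //.
  - by apply: emeasurable_funM => //;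
      exact: measurable_near_integral.
  - by move=> x; rewrite mule_ge0// integral_ge0.
  - exact: n0.
move=> /(ae_ball_exists x0 ltr01)[x _ hx]; exists (f x).
have : {ae mu, forall y, forall n : nat, ball x n.+1%:R y -> osc f (x, y) = 0%E}.
  apply: ae_foralln => n; apply: ge0_integral_eq0_ae => //.
    exact: measurable_funTS.
  have /eqP := hx n I; rewrite mule_eq0 => /orP[|/eqP//].
  by rewrite eqe invr_eq0 gt_eqF// (vol_gt0 CP).
apply: filterS => y /(_ (Num.truncn (mdist x y))).
move=> /(_ ((ballP _ _ _).2 (truncnS_gt _))) []/eqP.
by rewrite powR_eq0 => /andP[/eqP/normr0_eq0/eqP]; rewrite subr_eq0 => /eqP.
Qed.

(** The tent function of height [s] over [ball x0 s] is 1-Lipschitz with bounded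
support, so its energy at any radius below 1 is at most the measure of a ball.
As [s] is half the distance of the two points, the tent is positive near [x0] and
vanishes near [x1]. *)
Lemma KS_nonconstant (x0 x1 : X) : x0 != x1 ->
  exists2 f, KS mu p 1 f & ~ ae_constant mu f.
Proof.
rewrite -mdist_gt0 => d0; pose s := mdist x0 x1 / 2.
have s0 : 0 < s by exact: divr_gt0.
have s10 : 0 < s + 1 by rewrite addr_gt0.
have mb : measurable_fun setT (tent s x0) by exact: measurable_tent.
exists (tent s x0); last first.
  move=> [c ac].
  have [u xu uc] := ae_ball_exists x0 s0 ac.
  have [v xv vc] := ae_ball_exists x1 s0 ac.
  move/ballP: xu => xu; move/ballP: xv => xv.
  have fv : tent s x0 v = 0.
    rewrite /tent max_l//; have := metric_triangle x0 v x1.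
    by rewrite (metric_sym v x1) /s in xv *; lra.
  have : 0 < tent s x0 u by rewrite /tent lt_max subr_gt0 xu orbT.
  by rewrite uc -vc fv ltxx.
split.
  apply/LfunE; split => //.
  apply: (@le_lt_trans _ _ (\int[mu]_x ((s `^ p)%:E * (\1_(ball x0 s) x)%:E))%E).
    apply: ge0_le_integral => //.
    - exact: mabs.
    - by apply: emeasurable_funM => //; exact/measurable_EFinP/measurable_indic.
    move=> x _; rewrite -EFinM lee_fin.
    have := tent_le x0 x s0; rewrite indic_ball; case: ltP => _.
      by rewrite !mulr1 => h; apply: powR_le_compat => //; exact: ltW.
    by rewrite !mulr0 normr_le0 => /eqP ->; rewrite normr0 powR0// gt_eqF.
  rewrite ge0_integralZl//; last 2 first.
  - exact/measurable_EFinP/measurable_indic.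
  - by rewrite lee_fin powR_ge0.
  by rewrite integral_indic_ball// -EFinM ltry.
apply: (@le_lt_trans _ _ (vol x0 (s + 1))%:E); last exact: ltry.
apply: ge_ereal_inf; eexists.
  exists [set r | 0 < r < 1]; last by reflexivity.
  near=> r; apply/andP; split; near: r; [exact: nbhs_right_gt|exact: nbhs_right_lt].
apply: ge_ereal_sup => _ [r /= /andP[r0 r1] <-].
have rp0 : 0 < r `^ p by exact: powR_gt0.
rewrite E_near_avg// mulr1 lee_pdivrMl//.
rewrite -integral_indic_ball// -ge0_integralZl//; last 2 first.
- exact/measurable_EFinP/measurable_indic.
- by rewrite lee_fin ltW.
apply: ge0_le_integral => //.
- by move=> x _; rewrite mule_ge0// integral_ge0.
- by apply: emeasurable_funM => //;
    exact: measurable_near_integral.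
- by apply: emeasurable_funM => //; exact/measurable_EFinP/measurable_indic.
move=> x _; have v0 := vol_gt0 CP x r0.
have mx : measurable_fun (ball x r) (fun y => osc (tent s x0) (x, y)).
  apply: measurable_funTS.
  exact: (measurableT_comp (measurable_osc mb) (measurable_fun_pair _ _)).
rewrite -EFinM indic_ball; case: ltP => xs.
  rewrite mulr1.
  apply: (@le_trans _ _ ((invvol r x)%:E *
      \int[mu]_(y in ball x r) cst (r `^ p)%:E y)%E).
    apply: lee_wpmul2l => //; apply: ge0_le_integral => //.
    move=> y /ballP xy; rewrite lee_fin; apply: powR_le_compat => //; first exact: ltW.
    rewrite !(tentC s x0); apply: (le_trans (tent_lipschitz s y x x0)).
    by rewrite metric_sym ltW.
  rewrite integral_cst// (mu_ball CP)// -!EFinM lee_fin mulrCA /invvol mulVf ?mulr1//.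
  by rewrite gt_eqF.
rewrite mulr0 integral0_eq ?mule0// => y /ballP xy.
have z u : s <= mdist x0 u -> tent s x0 u = 0 by move=> h; rewrite /tent max_l//; lra.
have dx : s <= mdist x0 x by lra.
have dy : s <= mdist x0 y.
  by have := metric_triangle x0 y x; rewrite (metric_sym y x); lra.
by rewrite /osc/= !z// subrr normr0 powR0// gt_eqF.
Unshelve. all: by end_near. Qed.

Lemma E_rescale alpha f r : measurable_fun setT f -> 0 < r ->
  (E mu p 1 f r = (r `^ (p * (alpha - 1)))%:E * E mu p alpha f r)%E.
Proof.
move=> mf r0; rewrite !E_near_avg// muleA -EFinM.
congr (_%:E * _)%E; rewrite mulr1.
have -> : p * alpha = p * (alpha - 1) + p by rewrite mulrBr mulr1 subrK.
rewrite powRD; last by rewrite (gt_eqF r0) implybT.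
by rewrite invfM mulrA mulfV ?mul1r// gt_eqF// powR_gt0.
Qed.

Lemma propertyP_one (x0 x1 : X) : x0 != x1 -> poincare mu p -> propertyP mu p 1.
Proof.
move=> x01 PI; split; first exact: KS_nonconstant x01.
have [K1 K10 h1] := E_le_relaxed_energy x0 PI.
have [K2 K20 h2] := relaxed_energy_le_liminf.
exists (Num.max 1 (K1 * K2)); first by rewrite le_max lexx.
move=> f [fL _]; have [mf _] := (LfunE f).1 fL.
apply: ge_ereal_sup => _ [r /= r0 <-].
apply: (le_trans (h1 _ _ mf r0)).
apply: (@le_trans _ _ (K1%:E * (K2%:E * limf_einf (E mu p 1 f) 0^'+))%E).
  by apply: lee_wpmul2l; [rewrite lee_fin ltW|exact: h2].
rewrite muleA -EFinM; apply: lee_wpmul2r.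
  by apply: limf_einf_ge0 => [|s]; [exact: filterT|exact: E_ge0].
by rewrite lee_fin le_max lexx orbT.
Qed.

(** Above the exponent 1 the energies at exponent 1 tend to 0, and the
comparison of all scales with small scales makes them vanish identically. *)
Lemma critical_exponent_eq1 (x0 : X) : propertyP mu p 1 -> critical_exponent mu p = 1%E.
Proof.
move=> [[f0 Kf0 nf0] [C' C'1 hC']].
have C'0 : 0 < C' by exact: lt_le_trans C'1.
apply/eqP; rewrite eq_le; apply/andP; split; last first.
  apply: ereal_sup_ubound; exists 1 => //; split => //; exists f0 => //.
  have [fL fs] := Kf0; split => //.
  apply: le_lt_trans (hC' _ Kf0) _; apply: lte_mul_pinfty => //.
    by rewrite lee_fin ltW.
  by apply: le_lt_trans fs; exact: limf_einf_le_esup.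
apply: ge_ereal_sup => _ [alpha [alpha0 [f [fL fB] nf]] <-].
rewrite lee_fin leNgt; apply/negP => alpha1; apply: nf.
have [mf _] := (LfunE f).1 fL.
have q0 : 0 < p * (alpha - 1) by rewrite mulr_gt0// subr_gt0.
move: fB; set S := ereal_sup _ => fB.
have ES r : 0 < r -> (E mu p alpha f r <= S)%E.
  by move=> r0; apply: ereal_sup_ubound; exists r.
have S0 : (0 <= S)%E by exact: le_trans (E_ge0 _ _ _) (ES 1 ltr01).
case: S S0 fB ES => [M M0 _ ES|//|//].
have small e : 0 < e -> (limf_esup (E mu p 1 f) 0^'+ <= e%:E)%E.
  move=> e0; pose t := (e / (M + 1)) `^ (p * (alpha - 1))^-1.
  have M1 : 0 < M + 1 by rewrite ltr_wpDl.
  have eM : 0 < e / (M + 1) by exact: divr_gt0.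
  have t0 : 0 < t by exact: powR_gt0.
  apply: ge_ereal_inf; eexists.
    exists [set r | 0 < r < t]; last by reflexivity.
    near=> r; apply/andP; split; near: r; [exact: nbhs_right_gt|exact: nbhs_right_lt].
  apply: ge_ereal_sup => _ [r /= /andP[r0 rt] <-].
  rewrite (E_rescale alpha)//.
  apply: (@le_trans _ _ ((e / (M + 1))%:E * M%:E)%E).
    apply: lee_pmul => //; [by rewrite lee_fin powR_ge0|exact: E_ge0| |exact: ES].
    rewrite lee_fin.
    have -> : e / (M + 1) = t `^ (p * (alpha - 1)).
      by rewrite /t -powRrM mulVf ?powRr1 ?(ltW eM)// gt_eqF.
    by apply: powR_le_compat; exact: ltW.
  rewrite -EFinM lee_fin mulrAC ler_pdivrMr//.
  by apply: (ler_wpM2l (ltW e0)); rewrite lerDl.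
have f1 : KS mu p 1 f by split => //; exact: le_lt_trans (small 1 ltr01) (ltry _).
have einf0 : (limf_einf (E mu p 1 f) 0^'+ <= 0)%E.
  apply/lee_addgt0Pr => e e0; rewrite add0e; apply: le_trans (small e e0).
  exact: limf_einf_le_esup.
apply: (near_avg_eq0_ae_constant x0) => // r r0.
have rp0 : 0 < r `^ p by exact: powR_gt0.
have E0 : E mu p 1 f r = 0%E.
  apply/eqP; rewrite eq_le E_ge0 andbT.
  apply: (@le_trans _ _ (C'%:E * limf_einf (E mu p 1 f) 0^'+)%E).
    by apply: le_trans (hC' _ f1); apply: ereal_sup_ubound; exists r.
  by rewrite mule_ge0_le0// lee_fin ltW.
move: E0; rewrite E_near_avg// mulr1 => /eqP.
by rewrite mule_eq0 => /orP[|/eqP//]; rewrite eqe invr_eq0 gt_eqF.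
Unshelve. all: by end_near. Qed.

Lemma relaxed_energy_Var (x0 x1 : X) : x0 != x1 -> poincare mu p ->
  exists C1 C2 : R, [/\ 0 < C1, 0 < C2 & forall f, KS mu p 1 f ->
    (C1%:E * (Var mu p f `^ p) <= relaxed_energy mu p f)%E /\
    (relaxed_energy mu p f <= C2%:E * (Var mu p f `^ p))%E].
Proof.
move=> x01 PI.
have crit := critical_exponent_eq1 x0 (propertyP_one x01 PI).
have [K1 K10 h1] := E_le_relaxed_energy x0 PI.
have [K2 K20 h2] := relaxed_energy_le_liminf.
exists K1^-1, K2; split; rewrite ?invr_gt0// => f [fL _].
have [mf _] := (LfunE f).1 fL.
have -> : (Var mu p f `^ p = limf_einf (E mu p 1 f) 0^'+)%E.
  rewrite /Var crit; apply: limf_einf_poweR => // [r|]; [exact: E_ge0|exact: filterT].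
split; last exact: h2.
rewrite lee_pdivrMl//; rewrite limf_einfE.
apply: ge_ereal_sup => _ [A FA <-].
have [r [Ar r0]] : exists r, A r /\ 0 < r.
  by apply: (@filter_ex _ (0 : R)^'+); apply: filterI => //; exact: nbhs_right_gt.
apply: le_trans (h1 _ _ mf r0).
by apply: ereal_inf_lbound; exists r.
Qed.

End doubling_space.

(** * The theorem *)

Section sigma_finite_of.
Context (R : realType) (d : measure_display) (T : measurableType d).
Variables (mu : {measure set T -> \bar R}) (h : sigma_finite setT mu).

(** A copy of [mu] that carries its sigma-finiteness, the form in which the
Tonelli theorem takes its measures. *)
Definition sigma_finite_of (_ : sigma_finite setT mu) : set T -> \bar R := mu.

HB.instance Definition _ := Measure.copy (sigma_finite_of h) mu.
HB.instance Definition _ :=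
  Measure_isSigmaFinite.Build _ _ _ (sigma_finite_of h) h.

Lemma sigma_finite_measureP : exists smu : {sigma_finite_measure set T -> \bar R},
  smu = mu :> {measure set T -> \bar R}.
Proof. by exists (sigma_finite_of h); exact: eq_measure. Qed.

End sigma_finite_of.

Theorem theorem5p1 (R : realType) (d : measure_display)
    (X : metricMeasurableType R d) (mu : {measure set X -> \bar R}) (p : R)
    (hX : exists x y : X, x != y)
    (hreg : borel_regular mu) (hdbl : doubling mu)
    (hp : 1 <= p) (hpoinc : poincare mu p) :
  propertyP mu p 1 /\
  (exists C1 C2 : R, [/\ 0 < C1, 0 < C2 &
     forall f : X -> R, KS mu p 1 f ->
       (C1%:E * (Var mu p f `^ p) <= relaxed_energy mu p f)%E /\
       (relaxed_energy mu p f <= C2%:E * (Var mu p f `^ p))%E]).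
Proof.
have om : forall U : set X, open U -> measurable U by case: hreg.
have [x0 [x1 x01]] := hX.
have [C CP] := doubling_withP om x0 hdbl.
have [smu smuE] := sigma_finite_measureP (doubling_sigma_finite om CP x0).
rewrite -smuE in CP hpoinc *; split; first exact: (propertyP_one om CP hp x01).
exact: (relaxed_energy_Var om CP hp x01).
Qed.
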